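(* Let $D = (V,A)$ be a directed acyclic graph, let $s,t \in V$, and let $\mathcal{P} \subseteq 2^{V \cup A}$ be the set of $s$-$t$-paths in $D$ (each path identified with the set of its nodes and arcs). Let $\pi \in [0,1]^{\mathcal{P}}$ satisfy the conservation law: $\pi_P + \pi_Q = \pi_{P \times_e Q} + \pi_{Q \times_e P}$ for all $P, Q \in \mathcal{P}$ and all $e \in P \cap Q$. Then there exists $\mu \in [0,1]^{V \cup A}$ such that $\pi_P = 1 - \sum_{e \in P}\mu_e$ for all $P \in \mathcal{P}$. Furthermore, such $\mu$ can be computed in time strongly polynomial in $|V|$, $|A|$ and $T_\pi$, where $T_\pi$ denotes the time for one call to an oracle that, given $P \in \mathcal{P}$, returns $\pi_P$.
   Context: Each $s$-$t$-path $P$ is linearly ordered by the order of traversal of its nodes and arcs. For $P, Q \in \mathcal{P}$ and $e \in P\cap Q$ (a node or an arc), $P \times_e Q$ denotes the $s$-$t$-path consisting of the elements of $P$ up to and including $e$ followed by the elements of $Q$ from $e$ onward (this is an $s$-$t$-path since $D$ is acyclic). *)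

(* Defs.v *)
From HB Require Import structures.
From mathcomp Require Import all_boot all_order all_algebra.

Set Implicit Arguments.
Unset Strict Implicit.
Unset Printing Implicit Defensive.

Import Order.TTheory GRing.Theory Num.Theory.
Local Open Scope ring_scope.

(* Parallel arcs are allowed; a simple digraph is the case where
   a |-> (src a, tgt a) is injective. *)
Record digraph := Digraph {
  vert : finType;
  arc : finType;
  src : arc -> vert;
  tgt : arc -> vert
}.

Definition elt (D : digraph) : finType := (vert D + arc D)%type.

Section Paths.
Variable D : digraph.
Implicit Types (u v s t : vert D) (w : seq (arc D)) (p q : seq (elt D)).

Fixpoint walk u w v : bool :=
  if w is a :: w' then (src a == u) && walk (tgt a) w' v else u == v.

Definition acyclic : Prop := forall v w, walk v w v -> w = [::].

(* The nodes and arcs of a walk in order of traversal: u, a1, tgt a1, a2, ... *)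
Fixpoint traversal u w : seq (elt D) :=
  inl u :: (if w is a :: w' then inr a :: traversal (tgt a) w' else [::]).

Definition st_traversal s t p : Prop :=
  exists w, [/\ walk s w t, p = traversal s w & uniq p].

Definition st_path s t (P : {set elt D}) : Prop :=
  exists p, st_traversal s t p /\ P = [set e in p].

(* P x_e Q on traversal sequences: p up to and including e, then q after e. *)
Definition cross p (e : elt D) q : seq (elt D) :=
  take (index e p).+1 p ++ drop (index e q).+1 q.

Variable R : realFieldType.

(* A vector indexed by the s-t-paths is a total function on sets of elements,
   of which only the values at s-t-paths matter. *)
Implicit Types (pi : {set elt D} -> R) (mu : elt D -> R).

Definition path_values_in_unit s t pi : Prop :=
  forall P, st_path s t P -> 0 <= pi P <= 1.

Definition conservation_law s t pi : Prop :=
  forall p q e, st_traversal s t p -> st_traversal s t q ->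
    e \in p -> e \in q ->
    pi [set x in p] + pi [set x in q] =
      pi [set x in cross p e q] + pi [set x in cross q e p].

Definition decomposes s t pi mu : Prop :=
  (forall e, 0 <= mu e <= 1) /\
  (forall P, st_path s t P -> pi P = 1 - \sum_(e in P) mu e).

End Paths.

(* The model of computation: structured programs for a random access machine
   with an oracle. Memory consists of arrays of natural numbers (addresses,
   counters, combinatorial data) and arrays of numbers of R, zero-initialised;
   a program names its arrays by literals and computes indices. *)

(* No multiplication on naturals: a step at most doubles the largest natural
   number in memory, so that unit cost is justified (bit lengths grow at most
   linearly with the running time). *)
Inductive nexpr :=
| NConst of nat
| NGet of nat & nexpr          (* NGet a i is cell i of array a *)
| NAdd of nexpr & nexpr
| NSub of nexpr & nexpr.       (* truncated *)

(* A cell of a numeric array: array name and index. *)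
Definition rloc : Type := (nat * nexpr)%type.

Inductive rop := Radd | Rsub | Rmul | Rdiv.

Inductive test :=
| TNle of nexpr & nexpr
| TNeq of nexpr & nexpr
| TRle of rloc & rloc.

Inductive cmd :=
| Skip
| NSet of nat & nexpr & nexpr
| RConst of rloc & int
| ROp of rop & rloc & rloc & rloc   (* destination first *)
| Call of rloc & nat & nat     (* query: contents of two natural arrays *)
| Seq of cmd & cmd
| If of test & cmd & cmd
| While of test & cmd.

Section Semantics.
Variable R : realFieldType.

(* oracle x y r: the query encoded by the arrays x, y is legal, with answer r *)
Variable oracle : (nat -> nat) -> (nat -> nat) -> R -> Prop.
(* the time charged for one oracle call *)
Variable T : nat.

Record state := State {
  nmem : nat -> nat -> nat;
  rmem : nat -> nat -> R
}.
Implicit Type st : state.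

Definition upd (X : Type) (m : nat -> nat -> X) (a i : nat) (x : X) :=
  fun a' i' => if (a' == a) && (i' == i) then x else m a' i'.

Fixpoint neval st (e : nexpr) : nat :=
  match e with
  | NConst c => c
  | NGet a i => nmem st a (neval st i)
  | NAdd e1 e2 => (neval st e1 + neval st e2)%N
  | NSub e1 e2 => (neval st e1 - neval st e2)%N
  end.

Fixpoint ncost (e : nexpr) : nat :=
  match e with
  | NConst _ => 1%N
  | NGet _ i => (ncost i).+1
  | NAdd e1 e2 | NSub e1 e2 => (ncost e1 + ncost e2).+1
  end.

Definition rget st (l : rloc) : R := rmem st l.1 (neval st l.2).

Definition rcost (l : rloc) : nat := (ncost l.2).+1.

Definition nset st (a i x : nat) : state := State (upd (nmem st) a i x) (rmem st).

Definition rset st (l : rloc) (x : R) : state :=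
  State (nmem st) (upd (rmem st) l.1 (neval st l.2) x).

Definition teval st (b : test) : bool :=
  match b with
  | TNle e1 e2 => (neval st e1 <= neval st e2)%N
  | TNeq e1 e2 => neval st e1 == neval st e2
  | TRle l1 l2 => rget st l1 <= rget st l2
  end.

Definition tcost (b : test) : nat :=
  match b with
  | TNle e1 e2 | TNeq e1 e2 => (ncost e1 + ncost e2).+1
  | TRle l1 l2 => (rcost l1 + rcost l2).+1
  end.

Definition rop_eval (o : rop) (x y : R) : option R :=
  match o with
  | Radd => Some (x + y)
  | Rsub => Some (x - y)
  | Rmul => Some (x * y)
  | Rdiv => if y == 0 then None else Some (x / y)
  end.

(* exec c st k tr st': started in st, program c halts in st' after time k; tr
   lists every number of R written to memory on the way. Division by zero and
   illegal oracle queries have no execution. *)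
Inductive exec : cmd -> state -> nat -> seq R -> state -> Prop :=
| ExecSkip st : exec Skip st 1 [::] st
| ExecNSet st a i e :
    exec (NSet a i e) st (ncost i + ncost e).+1 [::]
         (nset st a (neval st i) (neval st e))
| ExecRConst st l z :
    exec (RConst l z) st (rcost l).+1 [:: z%:~R] (rset st l z%:~R)
| ExecROp st o l l1 l2 x :
    rop_eval o (rget st l1) (rget st l2) = Some x ->
    exec (ROp o l l1 l2) st (rcost l + rcost l1 + rcost l2).+1 [:: x]
         (rset st l x)
| ExecCall st l a b x :
    oracle (nmem st a) (nmem st b) x ->
    exec (Call l a b) st (rcost l + T).+1 [:: x] (rset st l x)
| ExecSeq st st1 st2 c1 c2 k1 k2 tr1 tr2 :
    exec c1 st k1 tr1 st1 -> exec c2 st1 k2 tr2 st2 ->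
    exec (Seq c1 c2) st (k1 + k2) (tr1 ++ tr2) st2
| ExecIf st st1 b c1 c2 k tr :
    exec (if teval st b then c1 else c2) st k tr st1 ->
    exec (If b c1 c2) st (tcost b + k) tr st1
| ExecWhileF st b c :
    ~~ teval st b -> exec (While b c) st (tcost b) [::] st
| ExecWhileT st st1 st2 b c k1 k2 tr1 tr2 :
    teval st b -> exec c st k1 tr1 st1 -> exec (While b c) st1 k2 tr2 st2 ->
    exec (While b c) st (tcost b + k1 + k2) (tr1 ++ tr2) st2.

End Semantics.

Section Encoding.
Variables (R : realFieldType) (D : digraph).
Implicit Types (s t : vert D).

(* Nodes are numbered 0, ..., |V|-1 and arcs 0, ..., |A|-1 by enum_rank.
   Natural array 0 holds |V|, |A|, s, t; arrays 1 and 2 hold the tails and the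
   heads of the arcs. *)
Definition input_array s t (a : nat) : seq nat :=
  match a with
  | 0 => [:: #|vert D|; #|arc D|; enum_rank s : nat; enum_rank t : nat]
  | 1 => [seq (enum_rank (src x) : nat) | x <- enum (arc D)]
  | 2 => [seq (enum_rank (tgt x) : nat) | x <- enum (arc D)]
  | _ => [::]
  end.

Definition input_state s t : state R :=
  State (fun a i => nth 0%N (input_array s t a) i) (fun _ _ => 0).

(* A query is the incidence vector of a subset of V u A, a nonzero entry
   meaning membership. *)
Definition query_set (x y : nat -> nat) : {set elt D} :=
  [set e : elt D | match e with
                   | inl v => x (enum_rank v) != 0%N
                   | inr a => y (enum_rank a) != 0%N
                   end].

Definition path_oracle s t (pi : {set elt D} -> R) (x y : nat -> nat) (r : R) :
    Prop :=
  st_path s t (query_set x y) /\ r = pi (query_set x y).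

(* Numeric arrays 0 and 1 hold the output for the nodes and for the arcs. *)
Definition output (st : state R) (e : elt D) : R :=
  match e with
  | inl v => rmem st 0 (enum_rank v)
  | inr a => rmem st 1 (enum_rank a)
  end.

End Encoding.

(* A polynomial bound in three parameters. *)
Definition poly_bound (c d x y z : nat) : nat := (c * (x + y + z).+1 ^ d)%N.

(* Number of bits of the numerator and the denominator; up_log 2 n.+1 is the
   number of binary digits of n. *)
Definition bit_size (x : rat) : nat :=
  (up_log 2 `|numq x|.+1 + up_log 2 `|denq x|.+1)%N.

(* Polynomially many elementary arithmetic operations, comparisons, memory
   accesses and oracle calls, each call being charged T. *)
Definition decomposes_in_polynomial_time (prog : cmd) : Prop :=
  exists c d : nat, forall (R : realFieldType) (D : digraph) (s t : vert D)
      (pi : {set elt D} -> R) (T : nat),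
    acyclic D -> path_values_in_unit s t pi -> conservation_law s t pi ->
    exists (k : nat) (tr : seq R) (st : state R),
      [/\ exec (path_oracle s t pi) T prog (input_state R s t) k tr st,
          (k <= poly_bound c d #|vert D| #|arc D| T)%N
        & decomposes s t pi (output st)].

(* On rational data all numbers occurring have polynomially bounded bit size. *)
Definition has_polynomial_bit_size (prog : cmd) : Prop :=
  exists c d : nat, forall (D : digraph) (s t : vert D)
      (pi : {set elt D} -> rat) (T b : nat),
    acyclic D -> path_values_in_unit s t pi -> conservation_law s t pi ->
    (forall P, st_path s t P -> (bit_size (pi P) <= b)%N) ->
    forall (k : nat) (tr : seq rat) (st : state rat),
      exec (path_oracle s t pi) T prog (input_state _ s t) k tr st ->
      {in tr, forall x, (bit_size x <= poly_bound c d #|vert D| #|arc D| b)%N}.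

Definition strongly_polynomial_decomposition (prog : cmd) : Prop :=
  decomposes_in_polynomial_time prog /\ has_polynomial_bit_size prog.

(* Main.v *)
(* For every node u reachable from s fix a prefix p_u from s to u, and for every
   node u that can reach t a suffix q_u from u to t. The conservation law at u
   says that the loss w_a = pi(p_u q_u) - pi(p_u a q_v) incurred by leaving q_u
   through the arc a = (u, v) does not depend on the prefix, so that
   telescoping along a path P gives pi(P) = pi(q_s) - sum of w_a over the arcs
   of P. It remains to choose the suffixes so that all w_a are nonnegative (then
   w_a <= 1 is automatic): the nodes' suffixes are improved by rerouting u
   through a whenever w_a < 0. Rerouting at u only affects suffixes of nodes from
   which u can be reached, so after k passes over the arcs all nodes from which
   every walk has at most k arcs are settled, and |V| passes suffice. Every
   number written on the way is 0, 1, an oracle value or a difference of two of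
   these, which bounds the bit sizes. *)

From mathcomp Require Import all_boot all_order all_algebra.
From mathcomp Require Import zify ring lra.
Require Import Defs.

Set Implicit Arguments.
Unset Strict Implicit.
Unset Printing Implicit Defensive.

Import Order.TTheory GRing.Theory Num.Theory.
Local Open Scope ring_scope.

(** * Walks and pointer structures *)

(** The improvement of suffixes is Bellman-Ford without arc lengths: only whole paths can be valued,
    so two suffixes at u are compared by closing both with the same prefix p_u. The obstacle is that
    w_a depends on the suffix at v as well as on the one at u: a later rerouting at v can make w_a
    negative again for an arc a = (u, v) that had been dealt with. A comparison therefore settles
    nothing by itself, and progress is measured by the height of the tail of an arc. On the machine
    side, the time bound asks for one execution while the bit-size bound speaks of all of them.
    Loops whose bounds are fixed on entry give programs a total functional meaning, from which one
    execution is built; determinism transfers its trace to every other. *)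

Section Walks.
Variables (V A : finType) (near far : A -> V).
Implicit Types (u v : V) (a b : A) (w : seq A).

(** The direction of the arcs is a parameter. With ([src], [tgt]) this is [walk], and chains of
    pointers are suffixes towards [t]; with ([tgt], [src]) chains are prefixes traced back to
    [s]. *)
Fixpoint gwalk u w v : bool :=
  if w is a :: w' then (near a == u) && gwalk (far a) w' v else u == v.

Lemma gwalk_cat u w1 w2 v :
  reflect (exists2 x, gwalk u w1 x & gwalk x w2 v) (gwalk u (w1 ++ w2) v).
Proof.
elim: w1 u => [|a w1 IH] u /=.
  by apply: (iffP idP) => [|[x /eqP->]] //; exists u.
case: eqP => _ /=; last by constructor=> -[].
exact: IH.
Qed.

Definition gacyclic := forall v w, gwalk v w v -> w = [::].

Hypothesis acyc : gacyclic.

Lemma gwalk_uniq u w v : gwalk u w v -> uniq (map near w).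
Proof.
elim: w u => //= a w IH u /andP[/eqP _ ww]; rewrite (IH _ ww) andbT.
apply/negP => /mapP[b bw ab]; case/splitPr: bw ww => w1 w2.
move/gwalk_cat => [x wx /= /andP[/eqP bx _]].
have: gwalk (near a) (a :: w1) (near a) by rewrite /= eqxx ab bx.
by move/acyc.
Qed.

Lemma gwalk_size u w v : gwalk u w v -> (size w <= #|V|)%N.
Proof. by move=> /gwalk_uniq /card_uniqP; rewrite size_map => <-; apply: max_card. Qed.

Definition height_le k v := forall w v', gwalk v w v' -> (size w <= k)%N.

Lemma height_le_card v : height_le #|V| v.
Proof. by move=> w v'; apply: gwalk_size. Qed.

Lemma height_leS k v : height_le k v -> height_le k.+1 v.
Proof. by move=> h w v' /h; apply: leqW. Qed.

Lemma height_le_far k a : height_le k.+1 (near a) -> height_le k (far a).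
Proof. by move=> h w v' ww; apply: (h (a :: w) v'); rewrite /= eqxx. Qed.

Lemma height_le0_near a : ~ height_le 0 (near a).
Proof. by move=> /(_ [:: a] (far a)); rewrite /= !eqxx => /(_ isT). Qed.

(* [None]: not yet reached; [Some None]: the root; [Some (Some a)]: reached,
   with [a] leading towards the root. *)
Definition pointers := {ffun V -> option (option A)}.
Implicit Types X : pointers.

Fixpoint chain X k v : seq A :=
  if k is k'.+1 then
    if X v is Some (Some a) then a :: chain X k' (far a) else [::]
  else [::].

Definition pointers_to (r : V) X :=
  X r = Some None /\
  forall v, v != r -> X v ->
    exists a, [/\ X v = Some (Some a), near a = v & X (far a)].

Definition set_ptr X u a : pointers :=
  [ffun v => if v == u then Some (Some a) else X v].

Variable r : V.

Lemma pointers_arc X v a :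
  pointers_to r X -> X v = Some (Some a) -> near a = v /\ X (far a).
Proof.
move=> [Xr wf] e; have vr : v != r by apply/eqP => vr; rewrite vr Xr in e.
by case: (wf v vr); rewrite e // => b [[<-]].
Qed.

(** Every arc followed lowers the height, so the chain ends no later than the fuel does; fuel serves
    only to make the recursion structural. *)
Lemma chain_fuel X k v f g : pointers_to r X -> height_le k v ->
  (k <= f)%N -> (k <= g)%N -> chain X f v = chain X g v.
Proof.
move=> wf; elim: k v f g => [|k IH] v f g h lef leg.
  have e x : chain X x v = [::].
    case: x => //= x; case e: (X v) => [[a|]|] //.
    by have [an _] := pointers_arc wf e; rewrite -an in h; case/height_le0_near: h.
  by rewrite !e.
case: f lef => // f lef; case: g leg => // g leg /=.
case e: (X v) => [[a|]|] //; congr (_ :: _); apply: IH => //.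
by apply: height_le_far; have [-> _] := pointers_arc wf e.
Qed.

Lemma gwalk_chain_fuel X k v :
  pointers_to r X -> height_le k v -> X v -> gwalk v (chain X k v) r.
Proof.
move=> wf; elim: k v => [|k IH] v h Xv; (have [vr|vr] := eqVneq v r).
- by rewrite vr /=.
- case: (wf.2 v vr Xv) => a [_ an _]; rewrite -an in h.
  by case/height_le0_near: h.
- by rewrite /= vr wf.1 /=.
- case: (wf.2 v vr Xv) => a [e an Xa]; rewrite /= e /= an eqxx /=.
  by apply: IH => //; apply: height_le_far; rewrite an.
Qed.

Lemma gwalk_chain X v :
  pointers_to r X -> X v -> gwalk v (chain X #|V| v) r.
Proof. by move=> wf Xv; apply: gwalk_chain_fuel => //; apply: height_le_card. Qed.

(** Otherwise [a] followed by the chain of [far a] would be a closed walk at the root. *)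
Lemma near_neq_root X a : pointers_to r X -> X (far a) -> near a != r.
Proof.
move=> wf Xa; apply/eqP => ar.
have: gwalk (near a) (a :: chain X #|V| (far a)) (near a).
  by rewrite /= eqxx /= ar; apply: gwalk_chain.
by move/acyc.
Qed.

(** Only the mark of the root could be lost: a cycle of pointers would be a cycle of the digraph, so
    a new pointer never has to be checked against the old ones. *)
Lemma pointers_to_set X a :
  pointers_to r X -> X (far a) -> pointers_to r (set_ptr X (near a) a).
Proof.
move=> wf Xa; have ar := near_neq_root wf Xa; split.
  by rewrite ffunE eq_sym (negbTE ar) wf.1.
move=> v vr; rewrite ffunE; have [->|va] := eqVneq v (near a).
  by exists a; rewrite !ffunE; split => //; case: ifP.
move=> /(wf.2 v vr) [b [bX bn Xb]]; exists b; rewrite !ffunE; split=> //.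
by case: ifP.
Qed.

(** The chain of a node of height at most [k] visits only such nodes, hence never [u]. *)
Lemma chain_set_low X k f v u a :
  pointers_to r X -> height_le k v -> ~ height_le k u ->
  chain (set_ptr X u a) f v = chain X f v.
Proof.
move=> wf h hu; elim: f v h => //= f IH v h.
rewrite ffunE; case: eqP => [vu|_]; first by rewrite vu in h.
case e: (X v) => [[b|]|] //; congr (_ :: _); apply: IH.
have [bv _] := pointers_arc wf e.
by apply: height_le_far; apply: height_leS; rewrite bv.
Qed.

(** After its first arc the chain is at height at most [k], so only [v = u] has to be excluded
    separately. *)
Lemma chain_set_near X k f v u a :
  pointers_to r X -> height_le k.+1 v -> v != u -> ~ height_le k u ->
  chain (set_ptr X u a) f v = chain X f v.
Proof.
move=> wf h vu hu; case: f => //= f; rewrite ffunE (negbTE vu).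
case e: (X v) => [[b|]|] //; congr (_ :: _).
have [bv _] := pointers_arc wf e.
by apply: chain_set_low hu => //; apply: height_le_far; rewrite bv.
Qed.

Lemma far_neq_near a w : gwalk (far a) w (near a) = false.
Proof.
apply/negP => ww.
by have /acyc : gwalk (near a) (a :: w) (near a) by rewrite /= eqxx.
Qed.

Lemma chain_set_avoid X f v u a : pointers_to r X ->
  (forall w, ~~ gwalk v w u) -> chain (set_ptr X u a) f v = chain X f v.
Proof.
move=> wf; elim: f v => //= f IH v avoid.
have vu : v != u by apply: contra (avoid [::]) => /eqP ->; rewrite /= eqxx.
rewrite ffunE (negbTE vu); case e: (X v) => [[b|]|] //; congr (_ :: _).
apply: IH => w; apply: contra (avoid (b :: w)) => bw.
by rewrite /= (proj1 (pointers_arc wf e)) eqxx.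
Qed.

Lemma chain_set_self X a : pointers_to r X -> X (far a) ->
  chain (set_ptr X (near a) a) #|V| (near a) = a :: chain X #|V| (far a).
Proof.
move=> wf Xa.
have wf' := pointers_to_set wf Xa.
(* The new chain has one arc in front of the old one; one more unit of fuel leaves exactly [#|V|]
   for the tail. *)
rewrite (chain_fuel (g := #|V|.+1) wf' (height_le_card (v := _))) //.
rewrite /= ffunE eqxx; congr (_ :: _); apply: chain_set_avoid => // w.
by rewrite far_neq_near.
Qed.

Lemma set_ptr_set X u a b : set_ptr (set_ptr X u a) u b = set_ptr X u b.
Proof. by apply/ffunP => v; rewrite !ffunE; case: (v == u). Qed.

End Walks.

Lemma gwalk_rev (V A : finType) (near far : A -> V) u w v :
  gwalk far near u w v = gwalk near far v (rev w) u.
Proof.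
elim: w u => [|a w IH] u /=; first by rewrite eq_sym.
rewrite rev_cons -cats1 IH; apply/andP/gwalk_cat.
  by move=> [/eqP <- ww]; exists (near a); rewrite //= !eqxx.
by move=> [x ww /= /andP[/eqP -> ax]].
Qed.

Lemma gacyclic_rev (V A : finType) (near far : A -> V) :
  gacyclic near far -> gacyclic far near.
Proof.
move=> ac v w; rewrite gwalk_rev => /ac /(congr1 rev).
by rewrite revK.
Qed.

(** * Traversals of walks in an acyclic digraph *)

Section Traversals.
Variable D : digraph.
Implicit Types (u v s t : vert D) (w : seq (arc D)).
Hypothesis acyc : acyclic D.

Lemma walk_cat u w1 w2 v :
  reflect (exists2 x, walk u w1 x & walk x w2 v) (walk u (w1 ++ w2) v).
Proof. exact: gwalk_cat. Qed.

Lemma mem_traversal_node u w x :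
  (inl x \in traversal u w) = (x == u) || (x \in map (@tgt D) w).
Proof.
by elim: w u => [|a w IH] u //=; rewrite !inE //= IH.
Qed.

Lemma mem_traversal_arc u w a : (inr a \in traversal u w) = (a \in w).
Proof. by elim: w u => [|b w IH] u //=; rewrite !inE /= IH. Qed.

Lemma traversal_uniq u w v : walk u w v -> uniq (traversal u w).
Proof.
elim: w u => //= a w IH u /andP[/eqP <- ww]; rewrite (IH _ ww) inE /= andbT.
have cyc w' : walk (tgt a) w' (src a) = false by apply: far_neq_near.
rewrite mem_traversal_arc; apply/andP; split.
  apply/negP => h; have {h} : src a \in tgt a :: map (@tgt D) w.
    by rewrite inE -mem_traversal_node.
  rewrite inE => /orP[/eqP e|/mapP[b bw sb]].
    by have := cyc [::]; rewrite /= e eqxx.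
  case/splitPr: bw ww => w1 w2 /walk_cat[x w1x /= /andP[bx _]].
  have := cyc (w1 ++ [:: b]).
  suff -> : walk (tgt a) (w1 ++ [:: b]) (src a) by [].
  by apply/walk_cat; exists x => //=; rewrite bx sb eqxx.
apply/negP => aw; case/splitPr: aw ww => w1 w2 /walk_cat[x w1x /= /andP[/eqP ax _]].
by have := cyc w1; rewrite ax w1x.
Qed.

Lemma traversal_cat u w1 w2 v : walk u w1 v ->
  traversal u (w1 ++ w2) = traversal u w1 ++ behead (traversal v w2).
Proof.
elim: w1 u => [|a w1 IH] u /=; first by move/eqP->; case: w2.
by move=> /andP[_ ww]; rewrite (IH _ ww).
Qed.

Lemma traversal_last u w v : walk u w v ->
  exists p, traversal u w = rcons p (inl v).
Proof.
elim: w u => [|a w IH] u /=; first by move/eqP->; exists [::].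
by move=> /andP[_ /IH[p ->]]; exists (inl u :: inr a :: p).
Qed.

Lemma st_traversal_walk s t w : walk s w t -> st_traversal s t (traversal s w).
Proof. by move=> ww; exists w; split => //; apply: traversal_uniq ww. Qed.

(** Since a traversal has no repetitions, the end of its first half is the first occurrence of [u],
    so [take] and [drop] in [cross] cut exactly between the two halves. *)
Lemma index_traversal s t u w1 w2 : walk s w1 u -> walk u w2 t ->
  (index (inl u) (traversal s (w1 ++ w2))).+1 = size (traversal s w1).
Proof.
move=> h1 h2; have: uniq (traversal s (w1 ++ w2)).
  by apply: (@traversal_uniq _ _ t); apply/walk_cat; exists u.
rewrite (traversal_cat _ h1); have [p ->] := traversal_last h1.
rewrite cat_rcons cat_uniq => /and3P[_ /hasPn/(_ (inl u)) np _].
rewrite index_cat (negbTE (np _)) ?inE ?eqxx //=.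
by rewrite eqxx addn0 size_rcons.
Qed.

Lemma cross_traversal s t u w1 w2 w1' w2' :
  walk s w1 u -> walk u w2 t -> walk s w1' u -> walk u w2' t ->
  cross (traversal s (w1 ++ w2)) (inl u) (traversal s (w1' ++ w2')) =
    traversal s (w1 ++ w2').
Proof.
move=> h1 h2 h1' h2'; rewrite /cross.
rewrite (index_traversal h1 h2) (index_traversal h1' h2').
rewrite (traversal_cat _ h1) (traversal_cat _ h1') take_size_cat //.
by rewrite drop_size_cat // (traversal_cat _ h1).
Qed.

Lemma inl_in_traversal s t u w1 w2 : walk s w1 u -> walk u w2 t ->
  inl u \in traversal s (w1 ++ w2).
Proof.
move=> h1 h2; rewrite (traversal_cat _ h1) mem_cat.
by have [p ->] := traversal_last h1; rewrite mem_rcons inE eqxx.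
Qed.

(** * The conservation law along walks *)

Variables (R : realFieldType) (s t : vert D) (pi : {set elt D} -> R).
Hypothesis pi_unit : path_values_in_unit s t pi.
Hypothesis pi_cons : conservation_law s t pi.

Definition walk_value w := pi [set e in traversal s w].

Lemma walk_value_cross u w1 w2 w1' w2' :
  walk s w1 u -> walk u w2 t -> walk s w1' u -> walk u w2' t ->
  walk_value (w1 ++ w2) + walk_value (w1' ++ w2') =
    walk_value (w1 ++ w2') + walk_value (w1' ++ w2).
Proof.
move=> h1 h2 h1' h2'.
have tr x y : walk s x u -> walk u y t -> st_traversal s t (traversal s (x ++ y)).
  by move=> hx hy; apply: st_traversal_walk; apply/walk_cat; exists u.
rewrite /walk_value (@pi_cons _ _ (inl u) (tr _ _ h1 h2) (tr _ _ h1' h2')).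
- by rewrite (cross_traversal h1 h2 h1' h2') (cross_traversal h1' h2' h1 h2).
- exact: inl_in_traversal h1 h2.
- exact: inl_in_traversal h1' h2'.
Qed.

Lemma st_path_walk w : walk s w t -> st_path s t [set e in traversal s w].
Proof. by move=> ww; exists (traversal s w); split=> //; apply: st_traversal_walk. Qed.

(** * Improvement of suffixes by rerouting *)

Local Notation ptrs := (pointers (vert D) (arc D)).
Implicit Types (X : ptrs) (a b : arc D).
Variable pr : ptrs.
Hypothesis pr_wf : pointers_to (@tgt D) (@src D) s pr.

Definition prefix_arcs u := rev (chain (@src D) pr #|vert D| u).
Definition suffix_arcs X u := chain (@tgt D) X #|vert D| u.
Definition through X u := prefix_arcs u ++ suffix_arcs X u.
Definition node_value X u := walk_value (through X u).

Local Notation to_t := (pointers_to (@src D) (@tgt D) t).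
Local Notation hle := (height_le (@src D) (@tgt D)).

Let acycr : gacyclic (@tgt D) (@src D) := gacyclic_rev acyc.

Lemma walk_prefix u : pr u -> walk s (prefix_arcs u) u.
Proof.
move=> pu; have := gwalk_chain acycr pr_wf pu.
by rewrite gwalk_rev.
Qed.

Lemma walk_suffix X u : to_t X -> X u -> walk u (suffix_arcs X u) t.
Proof. exact: (gwalk_chain acyc). Qed.

Lemma walk_through X u : to_t X -> pr u -> X u -> walk s (through X u) t.
Proof.
move=> wf pu Xu; apply/walk_cat; exists u; first exact: walk_prefix.
exact: walk_suffix.
Qed.

Definition useful X a := pr (src a) && X (tgt a).
Definition reroute X a := set_ptr X (src a) a.

(** Besides nonnegativity of the loss, a suffix is demanded at the tail; when all arcs are tight,
    this propagates suffixes from [t] back to all nodes of s-t-paths. *)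
Definition tight X a := useful X a ->
  X (src a) /\ node_value (reroute X a) (src a) <= node_value X (src a).

(** A tail without a suffix first receives the one through [a]. Rerouting it again changes nothing,
    so both sides of the comparison then agree, and there are always two genuine paths to query. *)
Definition step X a :=
  if useful X a then
    let X1 := if X (src a) then X else reroute X a in
    if node_value (reroute X1 a) (src a) <= node_value X1 (src a)
    then X1 else reroute X1 a
  else X.

(** Once all arcs are tight and [pr] covers the nodes reachable from [s], an arc that is not useful
    lies on no s-t-path, which justifies the value 0. *)
Definition arc_weight X a : R :=
  if useful X a then node_value X (src a) - node_value (reroute X a) (src a)
  else 0.

Lemma reroute_on X a v : X v -> reroute X a v.
Proof. by rewrite ffunE; case: ifP. Qed.

Lemma reroute_src X a : reroute X a (src a).
Proof. by rewrite ffunE eqxx. Qed.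

Lemma node_value_reroute X a : to_t X -> X (tgt a) ->
  node_value (reroute X a) (src a) =
    walk_value (prefix_arcs (src a) ++ a :: suffix_arcs X (tgt a)).
Proof.
move=> wf Xa; rewrite /node_value /through /suffix_arcs.
by rewrite (chain_set_self acyc wf Xa).
Qed.

(** The strict inequality is conditional because the first suffix of a node improves on nothing. *)
Lemma step_cases X a : 
  (step X a = X /\ tight X a) \/
  [/\ useful X a, step X a = reroute X a &
     X (src a) -> node_value X (src a) < node_value (reroute X a) (src a)].
Proof.
rewrite /step /tight; have [ua|] := boolP (useful X a); last by left.
have [Xa|_] := boolP (isSome (X (src a))); last first.
  by right; rewrite /reroute set_ptr_set lexx; split.
by have [h|h] := leP; [left | right].
Qed.

Lemma tight_step X a : tight X a -> step X a = X.
Proof.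
move=> ta; rewrite /step; case: ifP => // ua.
by have [-> ->] := ta ua.
Qed.

Definition round_inv k j X :=
  [/\ to_t X, forall b, hle k (src b) -> tight X b
    & forall b, (enum_rank b < j)%N -> hle k.+1 (src b) -> tight X b].

(* Rerouting at a node that is not of height at most [k] leaves the suffixes
   from all nodes of height at most [k] alone. *)
Lemma round_step k j X a : enum_rank a = j :> nat ->
  round_inv k j X -> round_inv k j.+1 (step X a).
Proof.
move=> aj [wf low cur].
have [[-> ta]|[ua -> imp]] := step_cases X a.
  split=> // b; rewrite ltnS leq_eqVlt -aj => /orP[/eqP ab|]; last first.
    by rewrite aj; apply: cur.
  suff -> : b = a by [].
  by apply/enum_rank_inj/val_inj.
have [pa Xa] := andP ua.
(* Arcs leaving nodes of height at most [k] are already tight, which contradicts a strict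
   improvement. *)
have na : ~ hle k (src a).
  by move=> /low /(_ ua) [/imp lt1]; rewrite leNgt lt1.
have wf' : to_t (reroute X a) by apply: (pointers_to_set acyc).
have keep b : hle k.+1 (src b) -> tight X b -> tight (reroute X a) b.
  move=> hb tb /andP[pb X'b].
  have hb' : hle k (tgt b) by apply: height_le_far.
  have ba : tgt b != src a by apply/eqP => e; rewrite e in hb'.
  have Xb : X (tgt b) by move: X'b; rewrite ffunE (negbTE ba).
  have [Xsb le1] : X (src b) /\ node_value (reroute X b) (src b) <= node_value X (src b).
    by apply: tb; rewrite /useful pb.
  split; first exact: reroute_on.
  (* If [b] leaves the rerouted node, the value it is compared with has only grown. Otherwise the
     suffixes at both of its ends are untouched. *)
  have [sba|sba] := eqVneq (src b) (src a).
    rewrite /reroute sba set_ptr_set -sba; apply: (le_trans le1).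
    by rewrite sba; apply/ltW/imp; rewrite -sba.
  rewrite node_value_reroute // in le1; rewrite node_value_reroute //.
  rewrite /node_value /through /suffix_arcs.
  rewrite (chain_set_near _ _ wf hb sba na).
  by rewrite (chain_set_low _ _ wf hb' na).
split=> // b.
  by move=> hb; apply: keep; [apply: height_leS | apply: low].
rewrite ltnS leq_eqVlt -aj => /orP[/eqP ab|]; last first.
  by rewrite aj => bj hb; apply: keep => //; apply: cur.
have -> : b = a by apply/enum_rank_inj/val_inj.
by move=> _ _; rewrite /reroute set_ptr_set; split=> //; rewrite ffunE eqxx.
Qed.

Lemma round_start X : to_t X -> round_inv 0 0 X.
Proof. by move=> wf; split=> // b /height_le0_near. Qed.

Lemma round_next k X : round_inv k #|arc D| X -> round_inv k.+1 0 X.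
Proof. by move=> [wf _ cur]; split=> // b; apply: cur. Qed.

Lemma round_final X b : round_inv #|vert D| 0 X -> tight X b.
Proof. by move=> [_ low _]; apply: low; apply: height_le_card. Qed.

(** The constant left over by telescoping is charged to [s], which lies on every s-t-path. *)
Definition weight X (e : elt D) : R :=
  match e with
  | inl v => if (v == s) && X s then 1 - node_value X s else 0
  | inr a => arc_weight X a
  end.

(** * The decomposition obtained from tight suffixes *)

Hypothesis pr_closed : forall a, pr (src a) -> pr (tgt a).

Variable X : ptrs.
Hypothesis X_wf : to_t X.
Hypothesis X_tight : forall a, tight X a.

Lemma node_value_unit u : pr u -> X u -> 0 <= node_value X u <= 1.
Proof. by move=> pu Xu; apply/pi_unit/st_path_walk/walk_through. Qed.

Lemma weight_unit e : 0 <= weight X e <= 1.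
Proof.
case: e => [v|a] /=.
  case: ifP => [/andP[_ Xs]|]; last by rewrite lexx ler01.
  have ps : pr s by rewrite pr_wf.1.
  by have := node_value_unit ps Xs; lra.
rewrite /arc_weight; case: ifP => ua; last by rewrite lexx ler01.
have [Xa le1] := X_tight ua; have [pa Xta] := andP ua.
have h1 := node_value_unit pa Xa.
have h2 : 0 <= node_value (reroute X a) (src a) <= 1.
  apply/pi_unit/st_path_walk/walk_through => //; last exact: reroute_src.
  exact: (pointers_to_set acyc).
by lra.
Qed.

(** Backwards from [t]: a tight arc whose head has a suffix forces one at its tail. *)
Lemma walk_on w u : pr u -> walk u w t -> X u.
Proof.
elim: w u => [|a w IH] u pu /=; first by move/eqP->; rewrite X_wf.1.
move=> /andP[/eqP e ww]; rewrite -e in pu *.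
by have [] // := @X_tight a; rewrite /useful pu; apply: IH => //; apply: pr_closed.
Qed.

(** The prefix [w1] is general because it absorbs the arcs of [w] one by one, while [arc_weight] is
    measured with the fixed prefix of [src a]; conservation at [src a] equates the two
    differences. *)
Lemma walk_value_weight w w1 u : walk s w1 u -> pr u -> walk u w t ->
  walk_value (w1 ++ suffix_arcs X u) - walk_value (w1 ++ w) =
    \sum_(a <- w) arc_weight X a.
Proof.
elim: w w1 u => [|a w IH] w1 u h1 pu /=.
  move/eqP => ut; have -> : suffix_arcs X u = [::].
    by rewrite /suffix_arcs ut; case: #|vert D| => //= n; rewrite X_wf.1.
  by rewrite subrr big_nil.
move=> /andP[/eqP e ww]; rewrite -e in pu h1 *.
have pta := pr_closed pu.
have Xta := walk_on pta ww.
have Xa : X (src a) by apply: (@walk_on (a :: w)) => //=; rewrite eqxx.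
have h1a : walk s (w1 ++ [:: a]) (tgt a).
  by apply/walk_cat; exists (src a) => //=; rewrite !eqxx.
have {IH} := IH _ _ h1a pta ww.
rewrite -!catA /= big_cons => <-.
rewrite /arc_weight /useful pu Xta /= node_value_reroute // /node_value /through.
have hs := walk_suffix X_wf Xa.
have hs' : walk (src a) (a :: suffix_arcs X (tgt a)) t.
  by rewrite /= eqxx /=; apply: walk_suffix.
have := walk_value_cross h1 hs (walk_prefix pu) hs'.
by lra.
Qed.

Lemma chain_root : prefix_arcs s = [::].
Proof. by rewrite /prefix_arcs; case: #|vert D| => //= n; rewrite pr_wf.1. Qed.

Lemma sum_weight_traversal u w :
  \sum_(e <- traversal u w) weight X e =
  \sum_(v <- u :: map (@tgt D) w) weight X (inl v) + \sum_(a <- w) arc_weight X a.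
Proof.
elim: w u => [|a w IH] u; first by rewrite !big_seq1 big_nil addr0.
rewrite [traversal _ _]/= [map _ _]/= !big_cons IH big_cons.
by rewrite [weight X (inr a)]/=; lra.
Qed.

Lemma weight_decomposes : decomposes s t pi (weight X).
Proof.
split; first exact: weight_unit.
move=> P [p [[w [ww -> up]] ->]].
have -> : \sum_(e in [set e in traversal s w]) weight X e =
          \sum_(e <- traversal s w) weight X e.
  by rewrite [RHS]big_uniq //; apply: eq_bigl => e; rewrite inE.
rewrite sum_weight_traversal big_cons.
have ps : pr s by rewrite pr_wf.1.
have Xs : X s := walk_on ps ww.
(* Among the nodes only the first one contributes: the traversal has no repetitions, so [s] does not
   recur. *)
rewrite big1_seq => [|v /andP[_ vw]].
  rewrite /= eqxx Xs /= -(@walk_value_weight w [::] s) ?eqxx //=.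
  by rewrite /node_value /through chain_root /= /walk_value; lra.
rewrite /=; case: eqP vw => // -> sw; exfalso.
have := mem_traversal_node; have := traversal_uniq ww.
case: w ww up sw => //= a w /andP[_ _] _ sw /andP[+ _] _.
by rewrite inE /= mem_traversal_node -in_cons sw.
Qed.

End Traversals.

(** * Programs with bounded loops *)

(* [PFor i b p] runs [p] with the counter in cell 0 of natural array [i]; the
   bound is cell [b] of array 0, that is |V| for [b = 0] and |A| for [b = 1]. *)
Inductive prog :=
| PSkip
| PNSet of nat & nexpr & nexpr
| PRConst of rloc & bool
| PRSub of rloc & rloc & rloc
| PCall of rloc & nat & nat
| PSeq of prog & prog
| PIf of test & prog & prog
| PFor of nat & nat & prog.

Definition reg a := NGet a (NConst 0).
Definition bump i := NSet i (NConst 0) (NAdd (reg i) (NConst 1)).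
Definition below i b := TNle (NAdd (reg i) (NConst 1)) (NGet 0 (NConst b)).

Fixpoint compile p : cmd :=
  match p with
  | PSkip => Skip
  | PNSet a i e => NSet a i e
  | PRConst l b => RConst l (b : nat)%:Z
  | PRSub l l1 l2 => ROp Rsub l l1 l2
  | PCall l a b => Call l a b
  | PSeq p q => Seq (compile p) (compile q)
  | PIf b p q => If b (compile p) (compile q)
  | PFor i b p => Seq (NSet i (NConst 0) (NConst 0))
                      (While (below i b) (Seq (compile p) (bump i)))
  end.

Fixpoint nmods p : seq nat :=
  match p with
  | PNSet a _ _ => [:: a]
  | PSeq p q | PIf _ p q => nmods p ++ nmods q
  | PFor i _ p => i :: nmods p
  | _ => [::]
  end.

Fixpoint rmods p : seq nat :=
  match p with
  | PRConst l _ | PRSub l _ _ | PCall l _ _ => [:: l.1]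
  | PSeq p q | PIf _ p q => rmods p ++ rmods q
  | PFor _ _ p => rmods p
  | _ => [::]
  end.

(** Bounds and counters are changed by nothing but the loop itself, so the number of iterations is
    known on entry. *)
Fixpoint wf_prog p : bool :=
  match p with
  | PSeq p q | PIf _ p q => wf_prog p && wf_prog q
  | PFor i b p =>
      [&& (b < 2)%N, i != 0%N, i \notin nmods p, 0%N \notin nmods p & wf_prog p]
  | _ => true
  end.

Definition loop_bound (n m b : nat) := if b == 0%N then n else m.

(** Initialising a counter costs 3, a loop test 7 and an increment 6; 16 generously covers both 3 +
    7 around the loop and 7 + 6 per iteration. *)
Fixpoint cost_bound (n m T : nat) p : nat :=
  match p with
  | PSkip => 1
  | PNSet _ i e => (ncost i + ncost e).+1
  | PRConst l _ => (rcost l).+1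
  | PRSub l l1 l2 => (rcost l + rcost l1 + rcost l2).+1
  | PCall l _ _ => (rcost l + T).+1
  | PSeq p q => cost_bound n m T p + cost_bound n m T q
  | PIf b p q => tcost b + (cost_bound n m T p + cost_bound n m T q)
  | PFor _ b p => 16 + loop_bound n m b * (cost_bound n m T p + 16)
  end.

Lemma cost_bound_poly p :
  exists c d, forall n m T, (cost_bound n m T p <= poly_bound c d n m T)%N.
Proof.
have const k : exists c d, forall n m T, (k <= poly_bound c d n m T)%N.
  by exists k, 0%N => n m T; rewrite /poly_bound expn0 muln1.
have cadd (f g : nat -> nat -> nat -> nat) :
    (exists c d, forall n m T, (f n m T <= poly_bound c d n m T)%N) ->
    (exists c d, forall n m T, (g n m T <= poly_bound c d n m T)%N) ->
    (exists c d, forall n m T, (f n m T + g n m T <= poly_bound c d n m T)%N).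
  move=> [c [d f_le]] [c' [d' g_le]]; exists (c + c')%N, (d + d')%N => n m T.
  rewrite /poly_bound mulnDl; apply: leq_add.
    by apply: leq_trans (f_le _ _ _) _; rewrite leq_mul2l leq_pexp2l ?orbT ?leq_addr.
  by apply: leq_trans (g_le _ _ _) _; rewrite leq_mul2l leq_pexp2l ?orbT ?leq_addl.
elim: p => /=; try by move=> *; apply: const.
- move=> l _ _; exists (rcost l).+1, 1%N => n m T; rewrite /poly_bound expn1; nia.
- by move=> p IHp q IHq; apply: (cadd).
- by move=> b p IHp q IHq; apply: (cadd) => //; apply: (cadd).
- move=> _ b p IHp; apply: (cadd) => //.
  have [c [d le1]] := cadd (fun n m T => cost_bound n m T p) (fun _ _ _ => 16%N) IHp (const _).
  (* The number of iterations is absorbed by one more power of the base. *)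
  exists c, d.+1 => n m T; rewrite /poly_bound expnS mulnCA.
  apply: leq_mul (le1 n m T); rewrite /loop_bound; case: ifP => _; lia.
Qed.

(** * Functional meaning of programs and its agreement with execution *)

Section Semantics.
Variables (R : realFieldType) (D : digraph) (s t : vert D).
Variables (pi : {set elt D} -> R) (T : nat).
Local Notation state := (state R).
Implicit Types (st : state) (p q : prog).

Definition query st a b := query_set D (nmem st a) (nmem st b).

(** Total: every query is answered by [pi], whether or not it encodes a path. The obligations are
    kept apart in [legal]. *)
Fixpoint run p st : state :=
  match p with
  | PSkip => st
  | PNSet a i e => nset st a (neval st i) (neval st e)
  | PRConst l b => rset st l (b : nat)%:Z%:~R
  | PRSub l l1 l2 => rset st l (rget st l1 - rget st l2)
  | PCall l a b => rset st l (pi (query st a b))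
  | PSeq p q => run q (run p st)
  | PIf b p q => if teval st b then run p st else run q st
  | PFor i b p =>
      iter (nmem st 0 b)
        (fun st' => let st'' := run p st' in nset st'' i 0 (nmem st'' i 0 + 1))
        (nset st i 0 0)
  end.

Definition source (x : R) :=
  [\/ x = 0, x = 1 | exists2 P, st_path s t P & x = pi P].

(** Beyond legality of the queries, operands of a subtraction must be sources: no difference enters
    another difference, so bit sizes cannot accumulate. *)
Fixpoint legal p st : Prop :=
  match p with
  | PRSub _ l1 l2 => source (rget st l1) /\ source (rget st l2)
  | PCall _ a b => st_path s t (query st a b)
  | PSeq p q => legal p st /\ legal q (run p st)
  | PIf b p q => if teval st b then legal p st else legal q st
  | PFor i b p =>
      forall j, (j < nmem st 0 b)%N -> legal p
        (iter j
          (fun st' => let st'' := run p st' in nset st'' i 0 (nmem st'' i 0 + 1))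
          (nset st i 0 0))
  | _ => True
  end.

Lemma run_nframe p st a i : a \notin nmods p -> nmem (run p st) a i = nmem st a i.
Proof.
elim: p st => //=.
- by move=> b j e st; rewrite inE /upd => /negbTE ->.
- by move=> p IHp q IHq st; rewrite mem_cat negb_or => /andP[ap aq]; rewrite IHq ?IHp.
- move=> b p IHp q IHq st; rewrite mem_cat negb_or => /andP[ap aq].
  by case: ifP; rewrite (IHp, IHq).
- move=> j b p IHp st; rewrite inE negb_or => /andP[aj ap].
  elim: (nmem st 0 b) => [|k IHk] /=; first by rewrite /upd (negbTE aj).
  by rewrite /upd (negbTE aj) /= IHp.
Qed.

Lemma run_rframe p st a i : a \notin rmods p -> rmem (run p st) a i = rmem st a i.
Proof.
elim: p st => //=.
- by move=> l b st; rewrite inE /upd => /negbTE ->.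
- by move=> l l1 l2 st; rewrite inE /upd => /negbTE ->.
- by move=> l a1 b1 st; rewrite inE /upd => /negbTE ->.
- by move=> p IHp q IHq st; rewrite mem_cat negb_or => /andP[ap aq]; rewrite IHq ?IHp.
- move=> b p IHp q IHq st; rewrite mem_cat negb_or => /andP[ap aq].
  by case: ifP; rewrite (IHp, IHq).
- move=> j b p IHp st ap; elim: (nmem st 0 b) => [|k IHk] //=.
  by rewrite IHp.
Qed.

(** The body is verified knowing that the counter equals the index and that everything the loop does
    not modify is as on entry; invariants need to mention only what changes. *)
Lemma for_rule (I : nat -> state -> Prop) i b p st :
  wf_prog (PFor i b p) -> I 0%N (nset st i 0 0) ->
  (forall j st', (j < nmem st 0 b)%N -> nmem st' i 0 = j ->
     (forall a k, a \notin nmods (PFor i b p) -> nmem st' a k = nmem st a k) ->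
     (forall a k, a \notin rmods p -> rmem st' a k = rmem st a k) ->
     I j st' ->
     legal p st' /\ I j.+1 (nset (run p st') i 0 (j + 1))) ->
  legal (PFor i b p) st /\ I (nmem st 0 b) (run (PFor i b p) st).
Proof.
move=> /= /and5P[_ i0 ip p0 wfp] I0 IS.
set F := fun st' : state => nset (run p st') i 0 (nmem (run p st') i 0 + 1).
have cnt j : nmem (iter j F (nset st i 0 0)) i 0 = j.
  elim: j => [|j IHj] /=; first by rewrite /upd !eqxx.
  by rewrite /F /= /upd !eqxx /= run_nframe // IHj addn1.
have nfr j a k : a \notin i :: nmods p ->
    nmem (iter j F (nset st i 0 0)) a k = nmem st a k.
  rewrite inE negb_or => /andP[ai ap].
  elim: j => [|j IHj] /=; first by rewrite /upd (negbTE ai).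
  by rewrite /upd (negbTE ai) /= run_nframe.
have rfr j a k : a \notin rmods p ->
    rmem (iter j F (nset st i 0 0)) a k = rmem st a k.
  by move=> ap; elim: j => [|j IHj] //=; rewrite run_rframe.
have main j : (j <= nmem st 0 b)%N -> I j (iter j F (nset st i 0 0)) /\
    forall k, (k < j)%N -> legal p (iter k F (nset st i 0 0)).
  elim: j => [|j IHj] lej; first by split.
  have [Ij legj] := IHj (ltnW lej).
  have [lp IS'] := IS j _ lej (cnt j) (nfr j) (rfr j) Ij.
  split; first by rewrite /= {1}/F /= run_nframe // cnt.
  by move=> k; rewrite ltnS leq_eqVlt => /orP[/eqP->|/legj].
by have [IN legN] := main _ (leqnn _); split.
Qed.

Definition written (x : R) := exists u v, [/\ source u, source v & x = u - v].

Lemma source_written x : source x -> written x.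
Proof. by move=> sx; exists x, 0; rewrite subr0; split=> //; constructor 1. Qed.

Lemma written_bool (b : bool) : written ((b : nat)%:Z%:~R).
Proof. by apply: source_written; case: b; [constructor 2|constructor 1]. Qed.

Lemma exec_compile p st n m : wf_prog p -> legal p st ->
  nmem st 0 0 = n -> nmem st 0 1 = m ->
  0%N \notin nmods p ->
  exists k tr, [/\ exec (path_oracle s t pi) T (compile p) st k tr (run p st),
    (k <= cost_bound n m T p)%N & {in tr, forall x, written x}].
Proof.
elim: p st => /=.
- by move=> st *; exists 1%N, [::]; split=> //; constructor.
- by move=> a i e st *; exists (ncost i + ncost e).+1, [::]; split=> //; constructor.
- move=> l b st *; exists (rcost l).+1, [:: (b : nat)%:Z%:~R]; split=> //.
    by constructor.
  by move=> x; rewrite inE => /eqP->; apply: written_bool.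
- move=> l l1 l2 st _ [s1 s2] *.
  exists (rcost l + rcost l1 + rcost l2).+1, [:: rget st l1 - rget st l2].
  split=> //; first by constructor.
  by move=> x; rewrite inE => /eqP->; exists (rget st l1), (rget st l2).
- move=> l a b st _ lq *; exists (rcost l + T).+1, [:: pi (query st a b)].
  split=> //; first by constructor.
  move=> x; rewrite inE => /eqP->; apply: source_written.
  by constructor 3; exists (query st a b).
- move=> p IHp q IHq st /andP[wp wq] [lp lq] n0 m0.
  rewrite mem_cat negb_or => /andP[p0 q0].
  have [k1 [tr1 [e1 c1 g1]]] := IHp st wp lp n0 m0 p0.
  have [||k2 [tr2 [e2 c2 g2]]] := IHq (run p st) wq lq _ _ q0.
  + by rewrite run_nframe.
  + by rewrite run_nframe.
  exists (k1 + k2)%N, (tr1 ++ tr2); split; first by econstructor; eauto.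
    exact: leq_add.
  by move=> x; rewrite mem_cat => /orP[/g1|/g2].
- move=> b p IHp q IHq st /andP[wp wq] lpq n0 m0.
  rewrite mem_cat negb_or => /andP[p0 q0].
  have [k [tr [e1 c1 g1]]] : exists k tr,
     [/\ exec (path_oracle s t pi) T (if teval st b then compile p else compile q)
          st k tr (if teval st b then run p st else run q st),
      (k <= cost_bound n m T p + cost_bound n m T q)%N & {in tr, forall x, written x}].
    move: lpq; case: ifP => _ lpq.
      have [k [tr [e1 c1 g1]]] := IHp st wp lpq n0 m0 p0.
      by exists k, tr; split=> //; apply: leq_trans c1 (leq_addr _ _).
    have [k [tr [e1 c1 g1]]] := IHq st wq lpq n0 m0 q0.
    by exists k, tr; split=> //; apply: leq_trans c1 (leq_addl _ _).
  exists (tcost b + k)%N, tr; split=> //; last by rewrite leq_add2l.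
  by constructor.
- move=> i b p IHp st /and5P[b2 i0 ip p0' wp] lp n0 m0.
  rewrite inE eq_sym (negbTE i0) /= => p0.
  set F := fun st' : state => nset (run p st') i 0 (nmem (run p st') i 0 + 1).
  rewrite -/F in lp *; set st0 := nset st i 0 0 in lp *.
  have cnt j : nmem (iter j F st0) i 0 = j.
    elim: j => [|j IHj] /=; first by rewrite /upd !eqxx.
    by rewrite /F /= /upd !eqxx /= run_nframe // IHj addn1.
  have nfr j k : nmem (iter j F st0) 0 k = nmem st 0 k.
    elim: j => [|j IHj] /=; first by rewrite /upd eq_sym (negbTE i0).
    by rewrite /upd eq_sym (negbTE i0) /= run_nframe.
  have Nb : nmem st 0 b = loop_bound n m b.
    by rewrite /loop_bound; case: b b2 {lp} => [|[|b]] //.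
  set N := nmem st 0 b in lp Nb *.
  (* Induction on the number [r] of iterations left; the 10 pays for the final, failing test. *)
  have main r j : (j + r = N)%N -> exists k tr,
      [/\ exec (path_oracle s t pi) T
           (While (below i b) (Seq (compile p) (bump i)))
           (iter j F st0) k tr (iter N F st0),
        (k <= r * (cost_bound n m T p + 16) + 10)%N
      & {in tr, forall x, written x}].
    elim: r j => [|r IHr] j jr.
      rewrite addn0 in jr; rewrite -jr; exists 7%N, [::]; split=> //.
      apply: (ExecWhileF _ _ (b := below i b)).
      by rewrite /= cnt nfr -/N -jr addn1 ltnn.
    have [||||k1 [tr1 [e1 c1 g1]]] := IHp (iter j F st0) wp.
    + by apply: lp; lia.
    + by rewrite nfr.
    + by rewrite nfr.
    + by [].
    have [|k2 [tr2 [e2 c2 g2]]] := IHr j.+1; first by lia.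
    exists (7 + (k1 + 6) + k2)%N, ((tr1 ++ [::]) ++ tr2); split.
    + apply: (ExecWhileT (b := below i b) (st1 := iter j.+1 F st0)) => //.
        by rewrite /= cnt nfr -/N; lia.
      by econstructor; [exact: e1 | exact: ExecNSet].
    + by move: c1 c2; lia.
    + by move=> x; rewrite cats0 mem_cat => /orP[/g1|/g2].
  have [k [tr [e1 c1 g1]]] := main N 0%N (add0n _).
  exists (3 + k)%N, ([::] ++ tr); split=> //.
    by econstructor; [exact: ExecNSet | exact: e1].
  by rewrite Nb in c1; move: c1; lia.
Qed.

(** The oracle relation determines its answer and each command has at most one applicable rule in a
    given state. *)
Lemma exec_det c st k tr st' k' tr' st'' :
  exec (path_oracle s t pi) T c st k tr st' ->
  exec (path_oracle s t pi) T c st k' tr' st'' -> tr = tr' /\ st' = st''.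
Proof.
move=> e; elim: e k' tr' st'' => {c st k tr st'}.
- by move=> st k' tr' st'' e; inversion e.
- by move=> st a i e k' tr' st'' e'; inversion e'.
- by move=> st l z k' tr' st'' e'; inversion e'.
- move=> st o l l1 l2 x ox k' tr' st'' e'; inversion e'; subst.
  by match goal with h : rop_eval _ _ _ = _ |- _ => move: h end; rewrite ox => -[->].
- move=> st l a b x [_ ->] k' tr' st'' e'; inversion e'; subst.
  by match goal with h : path_oracle _ _ _ _ _ _ |- _ => case: h => _ -> end.
- move=> st st1 st2 c1 c2 k1 k2 tr1 tr2 _ IH1 _ IH2 k' tr' st'' e'.
  inversion e' as [| | | | |? st1' ? ? ? ? ? ? ? x1 x2| | |]; subst.
  by have [-> e1] := IH1 _ _ _ x1; subst; have [-> ->] := IH2 _ _ _ x2.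
- move=> st st1 b c1 c2 k tr _ IH k' tr' st'' e'.
  by inversion e' as [| | | | | |? ? ? ? ? ? ? x1| |]; subst; apply: IH x1.
- move=> st b c nb k' tr' st'' e'.
  inversion e' as [| | | | | | | |? ? ? ? ? ? ? ? ? tb]; subst => //.
  by rewrite tb in nb.
- move=> st st1 st2 b c k1 k2 tr1 tr2 tb _ IH1 _ IH2 k' tr' st'' e'.
  inversion e' as [| | | | | | |? ? ? nb|? ? ? ? ? ? ? ? ? _ x1 x2]; subst.
    by rewrite tb in nb.
  by have [-> e1] := IH1 _ _ _ x1; subst; have [-> ->] := IH2 _ _ _ x2.
Qed.

End Semantics.

(** * The decomposition program *)

(* Natural arrays: 3 and 4 hold the pointers towards [s] and [t] (see [decode]),
   5 and 6 the query, 8, 9 and 10 the loop counters (9 is the current arc); cell 0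
   of 7, 11 and 12 holds the end of the chain being marked, the node queried and
   a saved pointer. Numeric arrays 2 and 3 hold oracle values. *)
Definition mark_chain P H :=
  PFor 10 0
    (PIf (TNle (NGet P (reg 7)) (NGet 0 (NConst 1)))
      (PSeq (PNSet 6 (NSub (NGet P (reg 7)) (NConst 1)) (NConst 1))
      (PSeq (PNSet 7 (NConst 0) (NGet H (NSub (NGet P (reg 7)) (NConst 1))))
            (PNSet 5 (reg 7) (NConst 1))))
      PSkip).

Definition clear_query :=
  PSeq (PFor 10 0 (PNSet 5 (reg 10) (NConst 0)))
       (PFor 10 1 (PNSet 6 (reg 10) (NConst 0))).

Definition query_through r :=
  PSeq clear_query
  (PSeq (PNSet 7 (NConst 0) (reg 11))
  (PSeq (PNSet 5 (reg 7) (NConst 1))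
  (PSeq (mark_chain 3 1)
  (PSeq (PNSet 7 (NConst 0) (reg 11))
  (PSeq (mark_chain 4 2)
        (PCall (r, NConst 0) 5 6)))))).

Arguments query_through : simpl never.

Definition this_arc := NAdd (reg 9) (NConst 1).
Definition this_src := NGet 1 (reg 9).
Definition this_tgt := NGet 2 (reg 9).

Definition reach :=
  PIf (TNeq (NGet 3 this_src) (NConst 0)) PSkip
  (PIf (TNeq (NGet 3 this_tgt) (NConst 0)) (PNSet 3 this_tgt this_arc) PSkip).

(** Each visit writes the current difference to the output cell of the arc; the values from earlier
    passes are provisional. On a tie the saved pointer is restored. *)
Definition relax_finish :=
  PSeq (PRSub (1%N, reg 9) (2, NConst 0) (3, NConst 0))
       (PIf (TRle (3, NConst 0) (2, NConst 0)) (PNSet 4 (reg 11) (reg 12)) PSkip).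

Definition relax_useful :=
  PSeq (PNSet 11 (NConst 0) this_src)
  (PSeq (PIf (TNeq (NGet 4 (reg 11)) (NConst 0))
             (PNSet 4 (reg 11) this_arc) PSkip)
  (PSeq (PNSet 12 (NConst 0) (NGet 4 (reg 11)))
  (PSeq (query_through 2)
  (PSeq (PNSet 4 (reg 11) this_arc)
  (PSeq (query_through 3) relax_finish))))).

Definition relax :=
  PIf (TNeq (NGet 3 this_src) (NConst 0)) (PRConst (1%N, reg 9) false)
  (PIf (TNeq (NGet 4 this_tgt) (NConst 0)) (PRConst (1%N, reg 9) false)
       relax_useful).

Definition root_mark := NAdd (NGet 0 (NConst 1)) (NConst 1).
Definition source_node := NGet 0 (NConst 2).

(** If [s] has no pointer towards [t], the initial zero in its output cell is kept. *)
Definition set_root :=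
  PIf (TNeq (NGet 4 source_node) (NConst 0)) PSkip
  (PSeq (PNSet 11 (NConst 0) source_node)
  (PSeq (query_through 2)
  (PSeq (PRConst (3, NConst 0) true)
        (PRSub (0%N, source_node) (3, NConst 0) (2, NConst 0))))).

(** The extra pass of [relax] moves no pointer: it rewrites all losses relative to the final
    suffixes. *)
Definition decomposition :=
  PSeq (PNSet 3 source_node root_mark)
  (PSeq (PNSet 4 (NGet 0 (NConst 3)) root_mark)
  (PSeq (PFor 8 0 (PFor 9 1 reach))
  (PSeq (PFor 8 0 (PFor 9 1 relax))
  (PSeq (PFor 9 1 relax) set_root)))).

(* 0, rank + 1 and |A| + 1 encode an unreached node, an arc and the root. *)
Definition decode (A : finType) (k : nat) : option (option A) :=
  if k is j.+1 then Some (onth (enum A) j) else None.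

Section Decode.
Variable A : finType.
Implicit Types a : A.

Lemma onth_enum a : onth (enum A) (enum_rank a) = Some a.
Proof.
by rewrite onthE (nth_map a) ?nth_enum_rank // -cardE.
Qed.

Lemma decode_arc a : decode A (enum_rank a).+1 = Some (Some a).
Proof. by rewrite /= onth_enum. Qed.

Lemma decode_root : decode A (#|A| + 1) = Some None.
Proof.
by rewrite addn1 /= onth_default // cardE.
Qed.

Lemma decode_Some k : isSome (decode A k) = (k != 0%N).
Proof. by case: k. Qed.

Lemma decode_arcE k a : decode A k = Some (Some a) -> k = (enum_rank a).+1.
Proof.
case: k => //= k [e]; congr (_.+1).
have lk : (k < #|A|)%N.
  rewrite ltnNge; apply/negP => le1.
  by move: e; rewrite onth_default // -cardE.
move: e; rewrite -[k in LHS]/(val (Ordinal lk)) -{1}(enum_valK (Ordinal lk)).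
by rewrite onth_enum => -[<-]; rewrite enum_valK.
Qed.

Lemma decode_arc_le k : decode A k -> (k <= #|A|)%N -> exists a, decode A k = Some (Some a).
Proof.
case: k => //= k _ lk; exists (enum_val (Ordinal lk)); congr Some.
by rewrite -[k in LHS]/(val (Ordinal lk)) -{1}(enum_valK (Ordinal lk)) onth_enum.
Qed.

Lemma decode_root_gt k : decode A k = Some None -> (k <= #|A|)%N = false.
Proof.
move=> e; apply/negP => /(@decode_arc_le k); rewrite e => /(_ isT) [a].
by [].
Qed.

End Decode.

Lemma rank_eq (A : finType) (a b : A) :
  ((enum_rank a : nat) == enum_rank b) = (a == b).
Proof. by rewrite -(inj_eq enum_rank_inj). Qed.

(** * Correctness of the decomposition program *)

Section Correctness.
Variables (R : realFieldType) (D : digraph) (s t : vert D).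
Variables (pi : {set elt D} -> R).
Hypothesis acyc : acyclic D.
Hypothesis pi_unit : path_values_in_unit s t pi.
Hypothesis pi_cons : conservation_law s t pi.

Local Notation state := (state R).
Local Notation ptrs := (pointers (vert D) (arc D)).
Local Notation run := (run pi).
Local Notation legal := (legal s t pi).
Local Notation source := (source s t pi).
Implicit Types (st : state) (u v : vert D) (a : arc D).

Record has_input st : Prop := HasInput {
  input_nodes : nmem st 0 0 = #|vert D|;
  input_arcs : nmem st 0 1 = #|arc D|;
  input_s : nmem st 0 2 = enum_rank s;
  input_t : nmem st 0 3 = enum_rank t;
  input_src : forall a, nmem st 1 (enum_rank a) = enum_rank (src a);
  input_tgt : forall a, nmem st 2 (enum_rank a) = enum_rank (tgt a)
}.

Lemma has_input_eq st st' : has_input st ->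
  (forall k i, (k < 3)%N -> nmem st' k i = nmem st k i) -> has_input st'.
Proof. by move=> [h1 h2 h3 h4 h5 h6] e; split=> [||||a|a]; rewrite e. Qed.

Definition ptr k st : ptrs := [ffun v => decode (arc D) (nmem st k (enum_rank v))].

Lemma ptr_eq k st st' :
  (forall i, nmem st' k i = nmem st k i) -> ptr k st' = ptr k st.
Proof. by move=> e; apply/ffunP => v; rewrite !ffunE e. Qed.

Lemma ptr_nset k st st' u a :
  (forall i, nmem st' k i = if i == enum_rank u then (enum_rank a).+1 else nmem st k i) ->
  ptr k st' = set_ptr (ptr k st) u a.
Proof.
move=> e; apply/ffunP => v; rewrite !ffunE e rank_eq.
by case: eqP => // _; rewrite decode_arc.
Qed.

Lemma ptr_on k st v : isSome (ptr k st v) = (nmem st k (enum_rank v) != 0%N).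
Proof. by rewrite ffunE decode_Some. Qed.

(** Chains towards [s] run against the arcs and collect tails instead of heads; the parameter [far]
    covers both directions. *)
Fixpoint far_traversal (far : arc D -> vert D) v w : seq (elt D) :=
  inl v :: (if w is a :: w' then inr a :: far_traversal far (far a) w' else [::]).

Local Notation q st := (@query R D st 5 6).

Lemma mem_query_node st v : (inl v \in q st) = (nmem st 5 (enum_rank v) != 0%N).
Proof. by rewrite inE. Qed.

Lemma mem_query_arc st a : (inr a \in q st) = (nmem st 6 (enum_rank a) != 0%N).
Proof. by rewrite inE. Qed.

Lemma mark_chain_spec near far r P H st v :
  P \notin [:: 10; 6; 7; 5]%N -> H \notin [:: 10; 6; 7; 5]%N ->
  has_input st -> (forall a, nmem st H (enum_rank a) = enum_rank (far a)) ->
  pointers_to near far r (ptr P st) -> ptr P st v ->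
  nmem st 7 0 = enum_rank v -> inl v \in q st ->
  legal (mark_chain P H) st /\
  forall e, (e \in q (run (mark_chain P H) st)) =
    (e \in q st) || (e \in far_traversal far v (chain far (ptr P st) #|vert D| v)).
Proof.
move=> Pm Hm inp Hfar wf von v7 vq.
(* What is marked, together with what lies ahead of the current node [v'], stays constant. The fuel
   ahead equals the iterations left; once at the root, the loop idles. *)
pose I j (st' : state) := exists v', [/\ nmem st' 7 0 = enum_rank v',
   inl v' \in q st', isSome (ptr P st v') &
   forall e, (e \in q st') ||
     (e \in far_traversal far v' (chain far (ptr P st) (#|vert D| - j) v')) =
   (e \in q st) || (e \in far_traversal far v (chain far (ptr P st) #|vert D| v))].
have [||leg [v' [_ v'q _ e]]] := @for_rule R D s t pi I 10 0
    (PIf (TNle (NGet P (reg 7)) (NGet 0 (NConst 1)))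
      (PSeq (PNSet 6 (NSub (NGet P (reg 7)) (NConst 1)) (NConst 1))
      (PSeq (PNSet 7 (NConst 0) (NGet H (NSub (NGet P (reg 7)) (NConst 1))))
            (PNSet 5 (reg 7) (NConst 1))))
      PSkip) st isT.
- by exists v; split=> // e; rewrite subn0 /query /=.
- move=> j st' ltj _ nfr _ [v' [v'7 v'q v'on e]].
  have fP k : nmem st' P k = nmem st P k by apply: nfr.
  have fH k : nmem st' H k = nmem st H k by apply: nfr.
  have f0 k : nmem st' 0 k = nmem st 0 k by apply: nfr.
  rewrite input_nodes // in ltj.
  split; first by rewrite /=; case: ifP.
  rewrite (_ : #|vert D| - j = (#|vert D| - j.+1).+1)%N in e; last by lia.
  have vP : nmem st P (enum_rank v') = nmem st' P (nmem st' 7 0) by rewrite fP v'7.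
  rewrite /I /= -vP f0 input_arcs //.
  case ev: (ptr P st v') v'on => [[a|]|] // _; move: (ev); rewrite ffunE.
    move=> /decode_arcE ka; rewrite ka ltn_ord /=.
    have na : (upd (nmem st') 6 ((enum_rank a).+1 - 1) 1 P
              (upd (nmem st') 6 ((enum_rank a).+1 - 1) 1 7 0) - 1 = enum_rank a)%N.
      move: Pm; rewrite !inE !negb_or => /and4P[_ P6 _ _].
      by rewrite /upd (negbTE P6) /= v'7 fP ka subn1.
    have hv : upd (nmem st') 6 ((enum_rank a).+1 - 1) 1%N H (enum_rank a) = enum_rank (far a).
      move: Hm; rewrite !inE !negb_or => /and4P[_ H6 _ _].
      by rewrite /upd (negbTE H6) /= fH Hfar.
    rewrite na hv; exists (far a); split=> //.
    - by rewrite mem_query_node /= /upd /= eqxx.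
    - by have [] := pointers_arc wf ev.
    - move=> e'; rewrite -e /= ev /=.
      case: e' => [x|b]; rewrite ?mem_query_node ?mem_query_arc !in_cons.
        rewrite /= /upd /= rank_eq; case: (eqVneq x (far a)) => [->|xf] /=.
          by case: (chain _ _ _ _) => [|? ?]; rewrite /= inE eqxx !orbT.
        case: (eqVneq x v') => [->|xv].
          by move: v'q; rewrite mem_query_node => ->.
        by rewrite -[inl x == inl v']/(x == v') (negbTE xv).
      rewrite /= /upd /= subn1 /= rank_eq -[inr b == inr a]/(b == a).
      by case: (eqVneq b a) => [->|ba] /=; rewrite ?orbT.
  move=> /decode_root_gt ->; exists v'; split; rewrite ?ev //= => e'.
  by rewrite -e /= ev; case: (#|vert D| - j.+1)%N => //= k; rewrite ev.
split=> // e'; rewrite -e input_nodes // subnn /=.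
rewrite mem_seq1; case: (eqVneq e' (inl v')) => [->|_]; last by rewrite orbF.
by rewrite v'q.
Qed.

Lemma mem_far_traversal_node far v w x :
  (inl x \in far_traversal far v w) = (x == v) || (x \in map far w).
Proof. by elim: w v => [|a w IH] v //=; rewrite !inE //= IH. Qed.

Lemma mem_far_traversal_arc far v w b : (inr b \in far_traversal far v w) = (b \in w).
Proof. by elim: w v => [|a w IH] v //=; rewrite !inE /= IH. Qed.

Lemma far_traversal_tgt v w : far_traversal (@tgt D) v w = traversal v w.
Proof. by elim: w v => //= a w IH v; rewrite IH. Qed.

(** The nodes of a walk are its start and the heads, or equally its end and the tails. This
    identifies a prefix traced back from its end with its forward traversal. *)
Lemma walk_nodes u w v x : walk u w v ->
  (x == u) || (x \in map (@tgt D) w) = (x == v) || (x \in map (@src D) w).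
Proof.
elim: w u => [|a w IH] u /=; first by move/eqP->.
by move=> /andP[/eqP<- /IH]; rewrite !inE => ->; rewrite orbCA.
Qed.

Lemma far_traversal_src u w v : walk u (rev w) v ->
  far_traversal (@src D) v w =i traversal u (rev w).
Proof.
move=> ww [x|b]; last by rewrite mem_far_traversal_arc mem_traversal_arc mem_rev.
by rewrite mem_far_traversal_node mem_traversal_node (walk_nodes _ ww) map_rev mem_rev.
Qed.

Lemma mem_traversal_cat u w1 w2 v e : walk u w1 v ->
  (e \in traversal u (w1 ++ w2)) = (e \in traversal u w1) || (e \in traversal v w2).
Proof.
move=> h1; rewrite (traversal_cat _ h1) mem_cat.
have [p ep] := traversal_last h1.
have vin : inl v \in traversal u w1 by rewrite ep mem_rcons inE eqxx.
have -> : traversal v w2 = inl v :: behead (traversal v w2) by case: w2.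
by rewrite in_cons; case: (eqVneq e (inl v)) => [->|]; rewrite ?vin.
Qed.

Lemma run_seq p1 p2 st : run (PSeq p1 p2) st = run p2 (run p1 st).
Proof. by []. Qed.

Lemma clear_query_spec st : has_input st ->
  legal clear_query st /\ forall e, e \notin q (run clear_query st).
Proof.
move=> inp; rewrite /clear_query.
pose I5 j (st' : state) :=
  forall v : vert D, (enum_rank v < j)%N -> nmem st' 5 (enum_rank v) = 0%N.
pose I6 j (st' : state) :=
  forall a : arc D, (enum_rank a < j)%N -> nmem st' 6 (enum_rank a) = 0%N.
have [||leg5 h5] := @for_rule R D s t pi I5 10 0 (PNSet 5 (reg 10) (NConst 0)) st isT.
- by [].
- move=> j st' ltj cj _ _ Ij; split=> // v lv.
  rewrite /= /upd /= cj; case: eqP => // /eqP vj; apply: Ij; by rewrite ltn_neqAle vj -ltnS.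
set st1 := run _ st in h5.
have fr1 k i : k \notin [:: 10; 5]%N -> nmem st1 k i = nmem st k i.
  by move=> kn; rewrite /st1 run_nframe.
have [||leg6 h6] := @for_rule R D s t pi I6 10 1 (PNSet 6 (reg 10) (NConst 0)) st1 isT.
- by [].
- move=> j st' ltj cj _ _ Ij; split=> // v lv.
  rewrite /= /upd /= cj; case: eqP => // /eqP vj; apply: Ij; by rewrite ltn_neqAle vj -ltnS.
split; first by split.
rewrite input_nodes // in h5; rewrite fr1 // input_arcs // in h6.
move=> [v|a]; rewrite ?mem_query_node ?mem_query_arc negbK; last first.
  by apply/eqP; apply: h6; apply: ltn_ord.
by rewrite run_seq -/st1 run_nframe //; apply/eqP; apply: h5; apply: ltn_ord.
Qed.

Lemma query_through_spec r st u :
  has_input st -> nmem st 11 0 = enum_rank u ->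
  pointers_to (@tgt D) (@src D) s (ptr 3 st) ->
  pointers_to (@src D) (@tgt D) t (ptr 4 st) ->
  ptr 3 st u -> ptr 4 st u ->
  [/\ legal (query_through r) st,
      rmem (run (query_through r) st) r 0 = node_value s pi (ptr 3 st) (ptr 4 st) u
    & source (node_value s pi (ptr 3 st) (ptr 4 st) u)].
Proof.
move=> inp u11 wf3 wf4 on3 on4.
have ww := walk_through acyc wf3 wf4 on3 on4.
have src_ok : source (node_value s pi (ptr 3 st) (ptr 4 st) u).
  by constructor 3; eexists; first exact: (st_path_walk acyc ww).
have [legc qc] := clear_query_spec inp.
set st1 := run clear_query st in qc.
have fr1 k i : k \notin nmods clear_query -> nmem st1 k i = nmem st k i.
  exact: run_nframe.
set st2 := run (PNSet 7 (NConst 0) (reg 11)) st1.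
set st3 := run (PNSet 5 (reg 7) (NConst 1)) st2.
have fr3 k i : k \notin 7%N :: nmods clear_query -> nmem st3 k i = nmem st k i.
  rewrite inE negb_or => /andP[k7 kc]; rewrite -fr1 // /= /upd (negbTE k7) /=.
  by case: eqP kc => // ->.
have inp3 : has_input st3 by apply: has_input_eq inp _ => -[|[|[|]]] // i _; rewrite fr3.
have p3 : ptr 3 st3 = ptr 3 st by apply: ptr_eq => i; rewrite fr3.
have st37 : nmem st3 7 0 = enum_rank u by rewrite /= /upd /= fr1.
(* Both chains start at [u], which [mark_chain] expects to be marked already. *)
have q3 e : (e \in q st3) = (e == inl u).
  have := qc e; case: e => [x|b]; rewrite ?mem_query_node ?mem_query_arc /= /upd /=.
    rewrite negbK => /eqP x0; rewrite (fr1 11%N) // u11 rank_eq -[RHS]/(x == u).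
    by case: (x == u) => //; rewrite x0.
  by move/negbTE => ->.
have [|||leg3 qq3] := @mark_chain_spec (@tgt D) (@src D) s 3 1 st3 u isT isT inp3
  (input_src inp3) _ _ st37 _; rewrite ?p3 ?q3 ?eqxx //.
set st4 := run (mark_chain 3 1) st3 in qq3.
set st5 := run (PNSet 7 (NConst 0) (reg 11)) st4.
have fr5 k i : k \notin [:: 10; 6; 7; 5]%N -> nmem st5 k i = nmem st k i.
  move=> kn; rewrite /= /upd; case: eqP kn => [->|_] // kn; rewrite /= run_nframe; last first.
    by move: kn; rewrite !inE !negb_or => /and4P[-> -> -> ->].
  by rewrite fr3 //; move: kn; rewrite !inE !negb_or => /and4P[-> -> -> ->].
have inp5 : has_input st5 by apply: has_input_eq inp _ => -[|[|[|]]] // i _; rewrite fr5.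
have p5 : ptr 4 st5 = ptr 4 st by apply: ptr_eq => i; rewrite fr5.
have st57 : nmem st5 7 0 = enum_rank u by rewrite /= /upd /= run_nframe // fr3.
have q5 e : (e \in q st5) = (e \in q st4) by case: e.
have [|||leg5 qq5] := @mark_chain_spec (@src D) (@tgt D) t 4 2 st5 u isT isT inp5
  (input_tgt inp5) _ _ st57 _; rewrite ?p5 ?q5 ?qq3 ?q3 ?eqxx //.
have qE : @query R D (run (mark_chain 4 2) st5) 5 6 =
    [set e in traversal s (through (ptr 3 st) (ptr 4 st) u)].
  apply/setP => e; rewrite [RHS]inE qq5 q5 qq3 q3 p3 p5.
  have hp := walk_prefix acyc wf3 on3.
  rewrite (mem_traversal_cat _ _ hp) far_traversal_tgt.
  rewrite (far_traversal_src hp) -/(prefix_arcs _ _).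
  case: (eqVneq e (inl u)) => [->|_] //=.
  by rewrite orbC mem_traversal_node eqxx.
split=> //; last first.
  rewrite !run_seq -/st1 -/st2 -/st3 -/st4 -/st5.
  by rewrite /= /upd /= eqxx /= -[query _ _ _ _]/(query D (run (mark_chain 4 2) st5) 5 6) qE.
split=> //; split=> //; split=> //; split=> //; split=> //; split=> //.
rewrite -/st1 -/st2 -/st3 -/st4 -/st5 /legal.
rewrite -[query _ _ _ _]/(query D (run (mark_chain 4 2) st5) 5 6) qE.
exact: st_path_walk.
Qed.

(** * Passes over the arcs: reachability, then relaxation *)

Local Notation to_s := (pointers_to (@tgt D) (@src D) s).
Local Notation to_t := (pointers_to (@src D) (@tgt D) t).

Lemma ex_rank (A : finType) j : (j < #|A|)%N -> exists a : A, enum_rank a = j :> nat.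
Proof. by move=> lj; exists (enum_val (Ordinal lj)); rewrite enum_valK. Qed.

Lemma legal_reach st : legal reach st.
Proof. by rewrite /=; case: ifP => //; case: ifP. Qed.

Lemma reach_spec st a : has_input st -> nmem st 9 0 = enum_rank a ->
  ptr 3 (run reach st) =
    if ptr 3 st (src a) && ~~ ptr 3 st (tgt a)
    then set_ptr (ptr 3 st) (tgt a) a else ptr 3 st.
Proof.
move=> inp a9; rewrite !ptr_on /= a9 (input_src inp) (input_tgt inp).
case: eqP => //= _; case: eqP => //= _.
by apply: ptr_nset => i; rewrite /= /upd /= addn1.
Qed.

Definition reach_inv k (pr : ptrs) :=
  to_s pr /\ forall w v, walk s w v -> (size w <= k)%N -> pr v.

Lemma reach_round st k : has_input st -> reach_inv k (ptr 3 st) ->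
  legal (PFor 9 1 reach) st /\ reach_inv k.+1 (ptr 3 (run (PFor 9 1 reach) st)).
Proof.
move=> inp [wf0 reached].
(* Only tails reached when the round began are relied upon; marks made during the round may add
   more. *)
pose I j (st' : state) := [/\ to_s (ptr 3 st'),
  forall v, ptr 3 st v -> ptr 3 st' v &
  forall a : arc D, (enum_rank a < j)%N -> ptr 3 st (src a) -> ptr 3 st' (tgt a)].
have [||leg [wf1 mono1 new1]] := @for_rule R D s t pi I 9 1 reach st isT.
- by split=> // v; rewrite !ptr_on.
- rewrite input_arcs // => j st' ltj cj nfr _ [wf1 mono1 new1].
  split; first exact: legal_reach.
  have [a aj] := ex_rank ltj.
  have inp' : has_input st'
    by apply: has_input_eq inp _ => -[|[|[|]]] // i _; rewrite nfr.
  have a9 : nmem st' 9 0 = enum_rank a by rewrite cj aj.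
  rewrite /I (_ : ptr 3 (nset _ _ _ _) = ptr 3 (run reach st')); last exact: ptr_eq.
  rewrite (reach_spec inp' a9).
  have [/andP[on_src off_tgt]|noreach] := boolP (_ && _); last first.
    split=> // b; rewrite ltnS leq_eqVlt -aj => /orP[/eqP ab|]; last by rewrite aj; apply: new1.
    have -> : b = a by apply/enum_rank_inj/val_inj.
    move=> /mono1 on_src; move: noreach; rewrite on_src /=.
    by rewrite negbK.
  have mono v : ptr 3 st' v -> set_ptr (ptr 3 st') (tgt a) a v.
    by rewrite [set_ptr _ _ _ _]ffunE; case: ifP.
  split.
  + exact: (pointers_to_set (gacyclic_rev acyc)).
  + by move=> v /mono1/mono.
  + move=> b; rewrite ltnS leq_eqVlt -aj => /orP[/eqP ab _|].
      have -> : b = a by apply/enum_rank_inj/val_inj.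
      by rewrite ffunE eqxx.
    by rewrite aj => lb /(new1 _ lb)/mono.
split=> //; split=> // w v; case/lastP: w => [|w a].
  by move=> /= /eqP <-; rewrite wf1.1.
rewrite -cats1 => /walk_cat[x sx /= /andP[/eqP ax /eqP <-]].
rewrite size_cat addn1 ltnS => lew; apply: new1; first by rewrite input_arcs // ltn_ord.
by rewrite ax; apply: reached lew.
Qed.

Lemma reach_all st : has_input st -> reach_inv 0 (ptr 3 st) ->
  legal (PFor 8 0 (PFor 9 1 reach)) st /\
  reach_inv #|vert D| (ptr 3 (run (PFor 8 0 (PFor 9 1 reach)) st)).
Proof.
move=> inp inv0; rewrite -(input_nodes inp).
apply: (@for_rule R D s t pi (fun k st' => reach_inv k (ptr 3 st'))) => //.
move=> k st' _ _ nfr _ invk.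
have inp' : has_input st'
  by apply: has_input_eq inp _ => -[|[|[|]]] // i _; rewrite nfr.
have [leg inv'] := reach_round inp' invk.
by split=> //; rewrite (_ : ptr 3 _ = ptr 3 (run (PFor 9 1 reach) st')) //; apply: ptr_eq.
Qed.

(** The prefix of [src a] extended by [a] is again a walk, hence has at most [#|vert D|] arcs and is
    covered by the rounds. *)
Lemma reach_closed (pr : ptrs) a : reach_inv #|vert D| pr -> pr (src a) -> pr (tgt a).
Proof.
move=> [wf reached] on_src.
have ww : walk s (prefix_arcs pr (src a) ++ [:: a]) (tgt a).
  apply/walk_cat; exists (src a); last by rewrite /= !eqxx.
  exact: walk_prefix.
by apply: (reached _ _ ww); apply: (gwalk_size acyc ww).
Qed.

Lemma relax_finish_rmem st : rmem (run relax_finish st) =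
  upd (rmem st) 1 (nmem st 9 0) (rmem st 2 0 - rmem st 3 0).
Proof. by rewrite /=; case: ifP. Qed.

Lemma relax_finish_nmem st i : nmem (run relax_finish st) 4 i =
  if rmem st 3 0 <= rmem st 2 0
  then if i == nmem st 11 0 then nmem st 12 0 else nmem st 4 i
  else nmem st 4 i.
Proof. by rewrite /= /rget /= /upd /=; case: ifP. Qed.

Lemma legal_relax_finish st :
  source (rmem st 2 0) -> source (rmem st 3 0) -> legal relax_finish st.
Proof. by move=> s2 s3; split=> //=; case: ifP. Qed.

Lemma run_nset k i e st : run (PNSet k i e) st = nset st k (neval st i) (neval st e).
Proof. by []. Qed.

Lemma nmem_nset st k i x k' i' :
  nmem (nset st k i x) k' i' = if (k' == k) && (i' == i) then x else nmem st k' i'.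
Proof. by []. Qed.

Lemma neval_reg st k : neval st (reg k) = nmem st k 0.
Proof. by []. Qed.

Lemma neval_arc st : neval st this_arc = (nmem st 9 0 + 1)%N.
Proof. by []. Qed.

Lemma relax_useful_spec st a :
  has_input st -> nmem st 9 0 = enum_rank a ->
  to_s (ptr 3 st) -> to_t (ptr 4 st) -> useful (ptr 3 st) (ptr 4 st) a ->
  let pr := ptr 3 st in let X := ptr 4 st in
  let X1 := if X (src a) then X else reroute X a in
  let v1 := node_value s pi pr X1 (src a) in
  let v2 := node_value s pi pr (reroute X1 a) (src a) in
  [/\ legal relax_useful st,
      ptr 4 (run relax_useful st) = if v2 <= v1 then X1 else reroute X1 a,
      rmem (run relax_useful st) 1 (enum_rank a) = v1 - v2 &
      forall b, b != a ->
        rmem (run relax_useful st) 1 (enum_rank b) = rmem st 1 (enum_rank b)].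
Proof.
move=> inp a9 wf3 wf4 /andP[on3 on4] pr X X1 v1 v2.
set st1 := run (PNSet 11 (NConst 0) this_src) st.
have st1_11 : nmem st1 11 0 = enum_rank (src a) by rewrite /= /upd /= a9 input_src.
pose c2 := PIf (TNeq (NGet 4 (reg 11)) (NConst 0)) (PNSet 4 (reg 11) this_arc) PSkip.
set st2 := run c2 st1.
have fr2 k i : k \notin [:: 11; 4]%N -> nmem st2 k i = nmem st k i.
  rewrite !inE negb_or => /andP[k11 k4]; rewrite /st2 run_nframe /= ?inE //.
  by rewrite /upd (negbTE k11).
have st2_11 : nmem st2 11 0 = enum_rank (src a) by rewrite /st2 run_nframe.
have p42 : ptr 4 st2 = X1.
  have p41 : ptr 4 st1 = X by apply: ptr_eq.
  rewrite /X1 -p41 ptr_on /st2 /=; have /= -> := st1_11.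
  case: eqP => //= _; apply: ptr_nset => i.
  by rewrite /= /upd /= a9 addn1.
set st3 := run (PNSet 12 (NConst 0) (NGet 4 (reg 11))) st2.
have fr3 k i : k \notin [:: 11; 4; 12]%N -> nmem st3 k i = nmem st k i.
  rewrite !inE !negb_or => /and3P[k11 k4 k12].
  rewrite /= /upd (negbTE k12) /=; rewrite fr2 ?inE ?negb_or ?k11 //.
have st3_11 : nmem st3 11 0 = enum_rank (src a) by [].
have st3_12 : nmem st3 12 0 = nmem st2 4 (enum_rank (src a)).
  by rewrite /= /upd /= st2_11.
have inp3 : has_input st3 by apply: has_input_eq inp _ => -[|[|[|]]] // i _; rewrite fr3.
have p33 : ptr 3 st3 = pr by apply: ptr_eq => i; rewrite fr3.
have p43 : ptr 4 st3 = X1 by rewrite -p42; apply: ptr_eq.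
have X1_src : X1 (src a) by rewrite /X1; case: ifP => // _; rewrite ffunE eqxx.
have X1_tgt : X1 (tgt a).
  by rewrite /X1; case: ifP => // _; rewrite ffunE; case: ifP.
have wfX1 : to_t X1 by rewrite /X1; case: ifP => // _; apply: (pointers_to_set acyc).
have := @query_through_spec 2 st3 (src a) inp3 st3_11.
rewrite p33 p43 => /(_ wf3 wfX1 on3 X1_src) [leg3 res4 src4].
set st4 := run (query_through 2) st3 in res4.
have fr4 k i : k \notin [:: 10; 6; 7; 5]%N -> nmem st4 k i = nmem st3 k i.
  rewrite !inE !negb_or => /and4P[k1 k2 k3 k4]; apply: run_nframe.
  by rewrite /= !inE !negb_or; do ![apply/andP; split] => //.
set st5 := run (PNSet 4 (reg 11) this_arc) st4.
have st4_11 : nmem st4 11 0 = enum_rank (src a) by rewrite fr4.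
have st4_9 : nmem st4 9 0 = enum_rank a by rewrite fr4 // fr3.
have st5_11 : nmem st5 11 0 = enum_rank (src a) by rewrite /st5 run_nset nmem_nset fr4.
have p45 : ptr 4 st5 = reroute X1 a.
  rewrite -p43; apply: ptr_nset => i.
  by rewrite /st5 run_nset nmem_nset neval_reg neval_arc st4_11 st4_9 addn1 fr4.
have fr5 k i : k \notin [:: 10; 6; 7; 5; 4; 11; 12]%N -> nmem st5 k i = nmem st k i.
  rewrite !inE !negb_or => /and5P[k1 k2 k3 k4 /and3P[k5 k6 k7]].
  rewrite /st5 run_nset nmem_nset (negbTE k5) fr4 ?fr3 // !inE !negb_or ?k5 ?k6 ?k7 //.
  by rewrite k1 k2 k3 k4.
have inp5 : has_input st5 by apply: has_input_eq inp _ => -[|[|[|]]] // i _; rewrite fr5.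
have p35 : ptr 3 st5 = pr by apply: ptr_eq => i; rewrite fr5.
have wfX2 : to_t (reroute X1 a) by apply: (pointers_to_set acyc).
have X2_src : reroute X1 a (src a) by rewrite ffunE eqxx.
have := @query_through_spec 3 st5 (src a) inp5 st5_11.
rewrite p35 p45 => /(_ wf3 wfX2 on3 X2_src) [leg5 res6 src6].
set st6 := run (query_through 3) st5 in res6.
have fr6 k i : k \notin [:: 10; 6; 7; 5]%N -> nmem st6 k i = nmem st5 k i.
  rewrite !inE !negb_or => /and4P[k1 k2 k3 k4]; apply: run_nframe.
  by rewrite /= !inE !negb_or; do ![apply/andP; split] => //.
have r62 : rmem st6 2 0 = v1 by rewrite /st6 run_rframe.
have st6_9 : nmem st6 9 0 = enum_rank a by rewrite fr6 // fr5.
have runE : run relax_useful st = run relax_finish st6 by exact: erefl.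
have st6_11 : nmem st6 11 0 = enum_rank (src a) by rewrite fr6.
have st6_12 : nmem st6 12 0 = nmem st2 4 (enum_rank (src a)).
  by rewrite fr6 // /st5 run_nset nmem_nset fr4.
have st6_4 i : nmem st6 4 i =
    if i == enum_rank (src a) then (enum_rank a).+1 else nmem st2 4 i.
  by rewrite fr6 // /st5 run_nset nmem_nset neval_reg neval_arc st4_11 st4_9 addn1 fr4.
split.
- split; first by [].
  split; first by rewrite /=; case: ifP.
  split; first by [].
  split; first exact: leg3.
  split; first by [].
  split; first exact: leg5.
  apply: legal_relax_finish; first by rewrite -[rmem _ _ _]/(rmem st6 2 0) r62.
  by rewrite -[rmem _ _ _]/(rmem st6 3 0) res6.
- case: ifP => le12.
    rewrite -p42; apply: ptr_eq => i; rewrite runE relax_finish_nmem r62 res6.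
    rewrite -/v1 -/v2 le12 st6_11 st6_12 st6_4.
    by case: eqP => [->|].
  rewrite -p45; apply: ptr_eq => i; rewrite runE relax_finish_nmem r62 res6.
  by rewrite -/v1 -/v2 le12 fr6.
- by rewrite runE relax_finish_rmem /upd st6_9 !eqxx r62 res6.
- move=> b ba; rewrite runE relax_finish_rmem /upd st6_9 rank_eq (negbTE ba) andbF.
  rewrite /st6 run_rframe // -[rmem st5]/(rmem st4) /st4 run_rframe //.
  by rewrite -[rmem st3]/(rmem st2) /st2 run_rframe.
Qed.

Lemma run_if b p1 p2 st :
  run (PIf b p1 p2) st = if teval st b then run p1 st else run p2 st.
Proof. by []. Qed.

Lemma legal_if b p1 p2 st :
  legal (PIf b p1 p2) st = if teval st b then legal p1 st else legal p2 st.
Proof. by []. Qed.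

Lemma relax_spec st a :
  has_input st -> nmem st 9 0 = enum_rank a ->
  to_s (ptr 3 st) -> to_t (ptr 4 st) ->
  [/\ legal relax st,
      ptr 4 (run relax st) = step s pi (ptr 3 st) (ptr 4 st) a,
      tight s pi (ptr 3 st) (ptr 4 st) a ->
        rmem (run relax st) 1 (enum_rank a) = arc_weight s pi (ptr 3 st) (ptr 4 st) a &
      forall b, b != a ->
        rmem (run relax st) 1 (enum_rank b) = rmem st 1 (enum_rank b)].
Proof.
move=> inp a9 wf3 wf4.
have t3 : teval st (TNeq (NGet 3 this_src) (NConst 0)) = ~~ ptr 3 st (src a).
  by rewrite ptr_on negbK /= a9 input_src.
have t4 : teval st (TNeq (NGet 4 this_tgt) (NConst 0)) = ~~ ptr 4 st (tgt a).
  by rewrite ptr_on negbK /= a9 input_tgt.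
have [ua|nua] := boolP (useful (ptr 3 st) (ptr 4 st) a); last first.
  have runE : run relax st = rset st (1%N, reg 9) 0 /\ legal relax st.
    move: nua; rewrite /useful /relax !run_if !legal_if t3 t4.
    by case: (isSome (ptr 3 st (src a))); case: (isSome (ptr 4 st (tgt a))).
  case: runE => runE leg.
  rewrite runE /step /arc_weight (negbTE nua); split=> //.
    by rewrite /= /upd /= a9 eqxx.
  by move=> b ba; rewrite /= /upd /= a9 rank_eq (negbTE ba).
have runE : run relax st = run relax_useful st /\
    (legal relax_useful st -> legal relax st).
  move: ua; rewrite /useful /relax !run_if !legal_if t3 t4 => /andP[-> ->].
  by split.
case: runE => -> leg_imp.
have [leg p4 r1 r2] := relax_useful_spec inp a9 wf3 wf4 ua.
split=> //; first exact: leg_imp.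
  by rewrite p4 /step ua.
move=> /(_ ua) [on_src _]; rewrite r1 /arc_weight ua on_src.
by [].
Qed.

Lemma relax_round st k : has_input st -> to_s (ptr 3 st) ->
  round_inv s t pi (ptr 3 st) k 0 (ptr 4 st) ->
  legal (PFor 9 1 relax) st /\
  round_inv s t pi (ptr 3 st) k.+1 0 (ptr 4 (run (PFor 9 1 relax) st)).
Proof.
move=> inp wf3 inv0.
pose I j (st' : state) := round_inv s t pi (ptr 3 st) k j (ptr 4 st').
have [||leg inv] := @for_rule R D s t pi I 9 1 relax st isT.
- by rewrite /I (_ : ptr 4 _ = ptr 4 st) //; apply: ptr_eq.
- rewrite input_arcs // => j st' ltj cj nfr _ invj.
  have [a aj] := ex_rank ltj.
  have inp' : has_input st'
    by apply: has_input_eq inp _ => -[|[|[|]]] // i _; rewrite nfr.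
  have a9 : nmem st' 9 0 = enum_rank a by rewrite cj aj.
  have p3 : ptr 3 st' = ptr 3 st by apply: ptr_eq => i; rewrite nfr.
  have wf3' : to_s (ptr 3 st') by rewrite p3.
  have wf4' : to_t (ptr 4 st') by case: invj.
  have [leg p4 _ _] := relax_spec inp' a9 wf3' wf4'.
  split=> //; rewrite /I (_ : ptr 4 _ = ptr 4 (run relax st')); last exact: ptr_eq.
  by rewrite p4 p3; apply: round_step.
split=> //; apply: round_next.
by rewrite -(input_arcs inp).
Qed.

Lemma relax_all st : has_input st -> to_s (ptr 3 st) -> to_t (ptr 4 st) ->
  legal (PFor 8 0 (PFor 9 1 relax)) st /\
  round_inv s t pi (ptr 3 st) #|vert D| 0 (ptr 4 (run (PFor 8 0 (PFor 9 1 relax)) st)).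
Proof.
move=> inp wf3 wf4; rewrite -(input_nodes inp).
apply: (@for_rule R D s t pi
  (fun k st' => round_inv s t pi (ptr 3 st) k 0 (ptr 4 st'))) => //.
  by rewrite (_ : ptr 4 _ = ptr 4 st); [apply: round_start|apply: ptr_eq].
move=> k st' _ _ nfr _ invk.
have inp' : has_input st'
  by apply: has_input_eq inp _ => -[|[|[|]]] // i _; rewrite nfr.
have p3 : ptr 3 st' = ptr 3 st by apply: ptr_eq => i; rewrite nfr.
rewrite -p3 in wf3 invk *.
have [leg inv'] := relax_round inp' wf3 invk.
by split=> //; rewrite (_ : ptr 4 _ = ptr 4 (run (PFor 9 1 relax) st')) //.
Qed.

(** As no pointer moves, the losses written in different iterations all refer to the same
    suffixes. *)
Lemma relax_last st : has_input st -> to_s (ptr 3 st) -> to_t (ptr 4 st) ->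
  (forall a, tight s pi (ptr 3 st) (ptr 4 st) a) ->
  [/\ legal (PFor 9 1 relax) st, ptr 4 (run (PFor 9 1 relax) st) = ptr 4 st &
   forall a, rmem (run (PFor 9 1 relax) st) 1 (enum_rank a) =
     arc_weight s pi (ptr 3 st) (ptr 4 st) a].
Proof.
move=> inp wf3 wf4 tgh.
pose I j (st' : state) := ptr 4 st' = ptr 4 st /\
  forall a : arc D, (enum_rank a < j)%N ->
    rmem st' 1 (enum_rank a) = arc_weight s pi (ptr 3 st) (ptr 4 st) a.
have [||leg [p4 wts]] := @for_rule R D s t pi I 9 1 relax st isT.
- by split=> //; apply: ptr_eq.
- rewrite input_arcs // => j st' ltj cj nfr _ [p4 wts].
  have [a aj] := ex_rank ltj.
  have inp' : has_input st'
    by apply: has_input_eq inp _ => -[|[|[|]]] // i _; rewrite nfr.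
  have a9 : nmem st' 9 0 = enum_rank a by rewrite cj aj.
  have p3 : ptr 3 st' = ptr 3 st by apply: ptr_eq => i; rewrite nfr.
  have := relax_spec inp' a9; rewrite p3 p4 => /(_ wf3 wf4) [leg p4' wa wb].
  split=> //; split.
    rewrite (_ : ptr 4 _ = ptr 4 (run relax st')); last exact: ptr_eq.
    by rewrite p4' tight_step.
  move=> b; rewrite ltnS leq_eqVlt -aj => /orP[/eqP ab|lb].
    have -> : b = a by apply/enum_rank_inj/val_inj.
    exact: wa.
  rewrite -[rmem (nset _ _ _ _)]/(rmem (run relax st')) wb; first by apply: wts; rewrite -aj.
  by apply: contraTneq lb => ->; rewrite ltnn.
split=> // a; apply: wts; by rewrite input_arcs // ltn_ord.
Qed.

Lemma set_root_spec st : has_input st -> to_s (ptr 3 st) -> to_t (ptr 4 st) ->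
  (forall v, rmem st 0 (enum_rank v) = 0) ->
  legal set_root st /\
  forall v, rmem (run set_root st) 0 (enum_rank v) =
    weight s pi (ptr 3 st) (ptr 4 st) (inl v).
Proof.
move=> inp wf3 wf4 zero; rewrite /weight ptr_on.
have [s0|sn0] := eqVneq (nmem st 4 (enum_rank s)) 0%N.
  have te : teval st (TNeq (NGet 4 source_node) (NConst 0)) by rewrite /= input_s // s0.
  by rewrite /set_root legal_if run_if te; split=> // v; rewrite andbF.
have te : teval st (TNeq (NGet 4 source_node) (NConst 0)) = false.
  by rewrite /= input_s //; apply: negbTE.
pose c := PSeq (PNSet 11 (NConst 0) source_node)
  (PSeq (query_through 2)
  (PSeq (PRConst (3, NConst 0) true)
        (PRSub (0%N, source_node) (3, NConst 0) (2, NConst 0)))).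
have [-> leg_imp] : run set_root st = run c st /\ (legal c st -> legal set_root st).
  by rewrite /set_root run_if legal_if te.
set st1 := run (PNSet 11 (NConst 0) source_node) st.
have fr1 k i : k != 11%N -> nmem st1 k i = nmem st k i.
  by move=> k11; rewrite /st1 run_nset nmem_nset (negbTE k11).
have inp1 : has_input st1 by apply: has_input_eq inp _ => -[|[|[|]]].
have p3 : ptr 3 st1 = ptr 3 st by apply: ptr_eq => i; rewrite fr1.
have p4 : ptr 4 st1 = ptr 4 st by apply: ptr_eq => i; rewrite fr1.
have st1_11 : nmem st1 11 0 = enum_rank s.
  by rewrite /st1 run_nset nmem_nset /= input_s.
have on3 : ptr 3 st s by rewrite wf3.1.
have on4 : ptr 4 st s by rewrite ptr_on.
have := @query_through_spec 2 st1 s inp1 st1_11.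
rewrite p3 p4 => /(_ wf3 wf4 on3 on4) [leg res src_ok].
set st2 := run (query_through 2) st1 in res.
have st2_s : nmem st2 0 2 = enum_rank s by rewrite /st2 run_nframe // fr1 // input_s.
have r0 v : rmem st2 0 (enum_rank v) = 0 by rewrite /st2 run_rframe //; apply: zero.
have tail_spec (st' : state) : rmem st' 2 0 = node_value s pi (ptr 3 st) (ptr 4 st) s ->
    nmem st' 0 2 = enum_rank s -> (forall v, rmem st' 0 (enum_rank v) = 0) ->
    let c' := PSeq (PRConst (3, NConst 0) true)
        (PRSub (0%N, source_node) (3, NConst 0) (2, NConst 0)) in
    legal c' st' /\ forall v, rmem (run c' st') 0 (enum_rank v) =
      if (v == s) && true then 1 - node_value s pi (ptr 3 st) (ptr 4 st) s else 0.
  move=> r2 n2 z /=; rewrite /rget /= /upd /= r2 n2; split.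
    by split=> //; split=> //; constructor 2.
  by move=> v; rewrite rank_eq andbT z.
have [legt rt] := tail_spec st2 res st2_s r0.
by split; [apply: leg_imp; split | exact: rt].
Qed.

Lemma has_input_input_state : has_input (input_state R s t).
Proof.
split=> //= a; rewrite (nth_map a) ?nth_enum_rank // -cardE; exact: ltn_ord.
Qed.

Lemma decomposition_spec :
  legal decomposition (input_state R s t) /\
  decomposes s t pi (output (run decomposition (input_state R s t))).
Proof.
set st0 := input_state R s t; have inp0 : has_input st0 := has_input_input_state.
set st1 := run (PNSet 3 source_node root_mark) st0.
set st2 := run (PNSet 4 (NGet 0 (NConst 3)) root_mark) st1.
have inp2 : has_input st2 by apply: has_input_eq inp0 _ => -[|[|[|]]].
have root_wf (near far : arc D -> vert D) k r :
    (forall v, nmem st2 k (enum_rank v) = if v == r then (#|arc D| + 1)%N else 0%N) ->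
    pointers_to near far r (ptr k st2).
  move=> e; split; first by rewrite ffunE e eqxx decode_root.
  by move=> v vr; rewrite ffunE e (negbTE vr).
have wf3 : to_s (ptr 3 st2).
  apply: root_wf => v; rewrite /st2 /st1 !run_nset !nmem_nset /= nth_nil.
  by rewrite rank_eq.
have wf4 : to_t (ptr 4 st2).
  apply: root_wf => v; rewrite /st2 /st1 !run_nset !nmem_nset /= nth_nil.
  by rewrite rank_eq.
have inv0 : reach_inv 0 (ptr 3 st2).
  by split=> // -[|a w] v //= /eqP <- _; rewrite wf3.1.
have [leg3 inv3] := reach_all inp2 inv0.
set st3 := run (PFor 8 0 (PFor 9 1 reach)) st2 in inv3.
have inp3 : has_input st3.
  by apply: has_input_eq inp2 _ => -[|[|[|]]] // i _; rewrite /st3 run_nframe.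
have p43 : ptr 4 st3 = ptr 4 st2 by apply: ptr_eq => i; rewrite /st3 run_nframe.
rewrite -p43 in wf4.
have [wf33 _] := inv3.
have [leg4 inv4] := relax_all inp3 wf33 wf4.
set st4 := run (PFor 8 0 (PFor 9 1 relax)) st3 in inv4.
have inp4 : has_input st4.
  by apply: has_input_eq inp3 _ => -[|[|[|]]] // i _; rewrite /st4 run_nframe.
have p34 : ptr 3 st4 = ptr 3 st3 by apply: ptr_eq => i; rewrite /st4 run_nframe.
rewrite -p34 in wf33 inv3 inv4.
have wf44 : to_t (ptr 4 st4) by case: inv4.
have tgh a : tight s pi (ptr 3 st4) (ptr 4 st4) a by apply: (round_final acyc inv4).
have [leg5 p45 wts] := relax_last inp4 wf33 wf44 tgh.
set st5 := run (PFor 9 1 relax) st4 in p45 wts.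
have inp5 : has_input st5.
  by apply: has_input_eq inp4 _ => -[|[|[|]]] // i _; rewrite /st5 run_nframe.
have p35 : ptr 3 st5 = ptr 3 st4 by apply: ptr_eq => i; rewrite /st5 run_nframe.
have zero v : rmem st5 0 (enum_rank v) = 0.
  by rewrite /st5 run_rframe // /st4 run_rframe // /st3 run_rframe.
have := @set_root_spec st5 inp5; rewrite p35 p45 => /(_ wf33 wf44 zero) [leg6 wn].
split.
  split; first by [].
  split; first by [].
  split; first exact: leg3.
  split; first exact: leg4.
  split; first exact: leg5.
  exact: leg6.
have [unit1 dec] := weight_decomposes acyc pi_unit pi_cons wf33
  (fun a => @reach_closed _ a inv3) wf44 tgh.
have outE e : output (run decomposition st0) e = weight s pi (ptr 3 st4) (ptr 4 st4) e.
  have -> : run decomposition st0 = run set_root st5 by exact: erefl.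
  case: e => [v|a]; first exact: wn.
  apply: etrans (wts a); rewrite -[LHS]/(rmem (run set_root st5) 1 (enum_rank a)).
  by rewrite run_rframe.
split=> [e|P /dec ->]; first by rewrite outE.
by congr (1 - _); apply: eq_bigr => e _; rewrite outE.
Qed.

End Correctness.

(** * Bit sizes *)

(** By coprimality, the numerator and the denominator in lowest terms divide those of any other
    representation. *)
Lemma num_den_div_le (x y : int) : y != 0 ->
  (`|numq (x%:~R / y%:~R)| <= `|x|)%N /\ (`|denq (x%:~R / y%:~R)| <= `|y|)%N.
Proof.
move=> y0; set z : rat := x%:~R / y%:~R.
have yQ : y%:~R != 0 :> rat by rewrite intr_eq0.
have eqZ : numq z * y = x * denq z.
  apply: (@intr_inj rat); rewrite !rmorphM /= numqE mulrAC /z.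
  by rewrite divfK.
have eqN : (`|numq z| * `|y| = `|x| * `|denq z|)%N by rewrite -!abszM eqZ.
have cop := coprime_num_den z.
split.
  have [x0|xn0] := eqVneq x 0; first by rewrite /z x0 mul0r.
  apply: dvdn_leq; first by rewrite absz_gt0.
  by rewrite -(Gauss_dvdl _ cop) -eqN dvdn_mulr.
apply: dvdn_leq; first by rewrite absz_gt0.
by rewrite -(@Gauss_dvdr _ `|numq z|%N) ?eqN ?dvdn_mull // coprime_sym.
Qed.

(** Over the product of the denominators, the numerator is below [2 ^ (2 * b + 1)] and the
    denominator below [2 ^ (2 * b)]; [4 * b + 2] charges [2 * b + 1] bits to each. *)
Lemma bit_size_sub (x y : rat) b :
  (bit_size x <= b)%N -> (bit_size y <= b)%N -> (bit_size (x - y) <= 4 * b + 2)%N.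
Proof.
have bnd (z : rat) : (bit_size z <= b)%N ->
    (`|numq z| < 2 ^ b)%N /\ (`|denq z| < 2 ^ b)%N.
  rewrite /bit_size => le1.
  have up k : (up_log 2 k.+1 <= b)%N -> (k < 2 ^ b)%N.
    by move=> le2; apply: (leq_trans (up_logP k.+1 (isT : 1 < 2)%N)); rewrite leq_exp2l.
  by split; apply: up; apply: leq_trans le1; rewrite (leq_addr, leq_addl).
move=> /bnd[nx dx] /bnd[ny dy].
pose n := numq x * denq y - numq y * denq x; pose d := denq x * denq y.
have dn0 : d != 0 by rewrite mulf_neq0 // denq_neq0.
have eqz : x - y = n%:~R / d%:~R.
  apply: (canRL (mulfK _)); first by rewrite intr_eq0.
  by rewrite /n /d rmorphB !rmorphM /= !numqE; ring.
have [le_n le_d] := num_den_div_le n dn0.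
rewrite -eqz in le_n le_d.
have leq_d : (`|d| < 2 ^ (2 * b))%N.
  by rewrite abszM mul2n -addnn expnD ltn_mul.
have leq_n : (`|n| < 2 ^ (2 * b + 1))%N.
  have h1 : (`|(numq x * denq y)%R| < 2 ^ (2 * b))%N.
    by rewrite abszM mul2n -addnn expnD ltn_mul.
  have h2 : (`|(numq y * denq x)%R| < 2 ^ (2 * b))%N.
    by rewrite abszM mul2n -addnn expnD ltn_mul.
  by rewrite expnD /n; lia.
rewrite /bit_size (_ : 4 * b + 2 = (2 * b + 1) + (2 * b + 1))%N; last by lia.
apply: leq_add; apply: up_log_min => //.
  exact: leq_ltn_trans le_n leq_n.
apply: (leq_ltn_trans le_d); apply: leq_trans leq_d _.
by rewrite leq_exp2l // leq_addr.
Qed.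

Theorem theorem8 :
  (forall (R : realFieldType) (D : digraph) (s t : vert D)
      (pi : {set elt D} -> R),
    acyclic D -> path_values_in_unit s t pi -> conservation_law s t pi ->
    exists mu : elt D -> R, decomposes s t pi mu) /\
  (exists prog : cmd, strongly_polynomial_decomposition prog).
Proof.
have exec_dec (R : realFieldType) (D : digraph) (s t : vert D) pi T :
    acyclic D -> path_values_in_unit s t pi -> conservation_law s t pi ->
    exists k tr st, [/\ exec (path_oracle s t pi) T (compile decomposition)
        (input_state R s t) k tr st,
      (k <= cost_bound #|vert D| #|arc D| T decomposition)%N,
      {in tr, forall x, written s t pi x} & decomposes s t pi (output st)].
  move=> acyc pi_unit pi_cons.
  have [leg dec] := decomposition_spec acyc pi_unit pi_cons.
  have [k [tr [ex kle trw]]] :=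
    @exec_compile R D s t pi T decomposition (input_state R s t) #|vert D| #|arc D|
      isT leg erefl erefl isT.
  by exists k, tr, (run pi decomposition (input_state R s t)).
split.
  move=> R D s t pi acyc pi_unit pi_cons.
  (* Existence is read off from the output of a run; the charge 0 per oracle call is arbitrary. *)
  have [k [tr [st [_ _ _ dec]]]] := exec_dec R D s t pi 0%N acyc pi_unit pi_cons.
  by exists (output st).
exists (compile decomposition); split.
  have [c [d cost_le]] := cost_bound_poly decomposition.
  exists c, d => R D s t pi T acyc pi_unit pi_cons.
  have [k [tr [st [ex kle _ dec]]]] := exec_dec R D s t pi T acyc pi_unit pi_cons.
  by exists k, tr, st; split=> //; apply: leq_trans kle (cost_le _ _ _).
(* Sources have at most [b + 2] bits, since 0 and 1 take at most 2; a difference then has at most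
   [4 * (b + 2) + 2 = 4 * b + 10] bits. *)
exists 10%N, 1%N => D s t pi T b acyc pi_unit pi_cons pi_size k tr st ex x.
have [k' [tr' [st' [ex' _ trw _]]]] := exec_dec rat D s t pi T acyc pi_unit pi_cons.
have [-> _] := exec_det ex ex'.
move=> /trw [u [v [su sv ->]]].
have src_size w : source s t pi w -> (bit_size w <= b + 2)%N.
  case=> [->|->|[P Pst ->]].
  - by rewrite (@leq_trans 2) ?leq_addl.
  - by rewrite (@leq_trans 2) ?leq_addl.
  - by rewrite (leq_trans (pi_size _ Pst)) ?leq_addr.
apply: leq_trans (bit_size_sub (src_size _ su) (src_size _ sv)) _.
by rewrite /poly_bound expn1; lia.
Qed.
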